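(* Let the mean-field system, information structure, weighting matrices, cost functional $J_\Gamma(v)$ and Problem 1 be as described in the context (in particular $v_i(\tau)$ is $\mathcal F_i(\tau)$-measurable, and $Q\ge 0$, $Q+\bar Q\ge 0$, $\mathcal R_i>0$, $\mathcal R_i+\bar{\mathcal R}_i>0$, $\Phi(\Gamma+1)\ge 0$, $\Phi(\Gamma+1)+\bar\Phi(\Gamma+1)\ge 0$). Then Problem 1 can be uniquely solved if and only if the following equilibrium condition is uniquely solvable for $0\le i\le h$, $i\le\tau\le\Gamma$: $$0=\mathcal R_i v_i(\tau)+\bar{\mathcal R}_i\,\mathbb E v_i(\tau)+\mathbb E[\mathcal B_i^T(\tau)\theta(\tau)\mid\mathcal F_i(\tau)]+\mathbb E[\bar{\mathcal B}_i^T(\tau)\theta(\tau)],$$ in which the costate $\theta(\tau)$ satisfies the backward iteration $$\theta(\tau-1)=Qx(\tau)+\bar Q\,\mathbb E x(\tau)+\mathbb E[\mathcal A^T(\tau)\theta(\tau)\mid\mathcal F_0(\tau)]+\mathbb E[\bar{\mathcal A}^T(\tau)\theta(\tau)]$$ with terminal condition $\theta(\Gamma)=\Phi(\Gamma+1)x(\Gamma+1)+\bar\Phi(\Gamma+1)\mathbb E x(\Gamma+1)$, and $x$ is the state of the system driven by the controls $v_i$.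
   Context: **System.** Fix integers $h\ge 0$ and $\Gamma\ge h$. The discrete-time mean-field system with $h+1$ controllers is, for $0\le\tau\le\Gamma$, $$x(\tau+1)=\Big[\mathcal A x(\tau)+\bar{\mathcal A}\,\mathbb E x(\tau)+\sum_{i=0}^h[\mathcal B_iv_i(\tau)+\bar{\mathcal B}_i\mathbb E v_i(\tau)]\Big]+\Big[Cx(\tau)+\bar C\,\mathbb E x(\tau)+\sum_{i=0}^h[D_iv_i(\tau)+\bar D_i\mathbb E v_i(\tau)]\Big]\omega(\tau),$$ where $x(\tau)\in\mathbb R^n$ is the state, $v_i(\tau)\in\mathbb R^{m_i}$ is the $i$-th control input, $\mathcal A,\bar{\mathcal A},C,\bar C\in\mathbb R^{n\times n}$ and $\mathcal B_i,\bar{\mathcal B}_i,D_i,\bar D_i\in\mathbb R^{n\times m_i}$ are deterministic matrices, $\omega(\tau)$ is a scalar Gaussian white noise with $\omega(\tau)\sim\mathcal N(0,\sigma^2)$, and the initial state $x(0)=\beta$ is given. $\mathbb E$ is expectation over the noise and the initial state. The initial controls $v_i(\tau)$, $0\le i\le h$, $0\le\tau\le i-1$, are given arbitrarily. **Notation.** $\mathcal A(\tau)=\mathcal A+\omega(\tau)C$, $\bar{\mathcal A}(\tau)=\bar{\mathcal A}+\omega(\tau)\bar C$, $\mathcal B_i(\tau)=\mathcal B_i+\omega(\tau)D_i$, $\bar{\mathcal B}_i(\tau)=\bar{\mathcal B}_i+\omega(\tau)\bar D_i$. For symmetric matrices, $>0$ (resp. $\ge0$) means positive definite (resp. positive semidefinite).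 **Information structure (Assumption).** $v_i(\tau)$ is $\mathcal F_i(\tau)$-measurable, where $\mathcal F_i(\tau)=\sigma\{\beta,\omega(0),\dots,\omega(\tau-i-1)\}$, augmented by all null sets. **Cost.** With deterministic symmetric weighting matrices $Q,\bar Q,\mathcal R_i,\bar{\mathcal R}_i,\Phi(\Gamma+1),\bar\Phi(\Gamma+1)$, $$J_\Gamma(v)=\sum_{\tau=0}^\Gamma\mathbb E\Big[x^T(\tau)Qx(\tau)+[\mathbb E x(\tau)]^T\bar Q\,\mathbb E x(\tau)+\sum_{i=0}^h\big[v_i^T(\tau)\mathcal R_iv_i(\tau)+[\mathbb E v_i(\tau)]^T\bar{\mathcal R}_i\mathbb E v_i(\tau)\big]\Big]+\mathbb E[x^T(\Gamma+1)\Phi(\Gamma+1)x(\Gamma+1)]+[\mathbb E x(\Gamma+1)]^T\bar\Phi(\Gamma+1)\mathbb E x(\Gamma+1).$$ **Weights (Assumption).** $Q\ge0$, $Q+\bar Q\ge0$, $\mathcal R_i>0$, $\mathcal R_i+\bar{\mathcal R}_i>0$, $\Phi(\Gamma+1)\ge0$, $\Phi(\Gamma+1)+\bar\Phi(\Gamma+1)\ge0$. **Problem 1.** Find $\mathcal F_i(\tau)$-measurable controllers $v_i(\tau)\in\mathbb R^{m_i}$, $i=0,\dots,h$ (for $i\le\tau\le\Gamma$, the earlier values being prescribed), minimizing $J_\Gamma(v)$. *)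

(* Defs.v *)
(* MathComp-Analysis: random vectors are functions into 'cV[R]_n, treated
   coordinatewise, over an abstract probability space (T, P). *)
From HB Require Import structures.
From mathcomp Require Import all_boot all_order all_algebra.
From mathcomp Require Import all_classical all_reals all_analysis.

Set Implicit Arguments.
Unset Strict Implicit.
Unset Printing Implicit Defensive.

Import Order.TTheory GRing.Theory Num.Theory.
Import numFieldNormedType.Exports.

Local Open Scope classical_set_scope.
Local Open Scope ring_scope.

Section QuadraticForms.
Context {R : realType} {n : nat}.

Definition qform (M : 'M[R]_n) (u : 'cV[R]_n) : R :=
  (u^T *m M *m u) ord0 ord0.

Definition sym (M : 'M[R]_n) : Prop := M^T = M.

Definition psd (M : 'M[R]_n) : Prop := forall u, 0 <= qform M u.

Definition pd (M : 'M[R]_n) : Prop := forall u, u != 0 -> 0 < qform M u.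

End QuadraticForms.

Section Probability.
Context {d : measure_display} {T : measurableType d} {R : realType}.
Variable P : probability T R.

Definition coord n (X : T -> 'cV[R]_n) (j : 'I_n) : T -> R :=
  fun w => X w j ord0.

Definition mean n (X : T -> 'cV[R]_n) : 'cV[R]_n :=
  \col_j fine 'E_P[coord X j].

Definition square_integrable n (X : T -> 'cV[R]_n) : Prop :=
  forall j, coord X j \in Lfun P 2%:E.

(* Sigma-algebras are given by a generating set system G. *)
Definition measurable_wrt (G : set_system T) n (X : T -> 'cV[R]_n) : Prop :=
  forall j, measurable_fun [set: g_sigma_algebraType G]
              (coord X j : g_sigma_algebraType G -> R).

(* Y is a version of E[X | <<s G>>] for the integrable vector X. *)
Definition cond_exp (G : set_system T) n (X Y : T -> 'cV[R]_n) : Prop :=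
  measurable_wrt G Y /\
  forall j,
    [/\ P.-integrable [set: T] (EFin \o coord X j),
        P.-integrable [set: T] (EFin \o coord Y j) &
        forall A, <<s G >> A ->
          (\int[P]_(w in A) (coord Y j w)%:E
           = \int[P]_(w in A) (coord X j w)%:E)%E].

Definition rv_gen (X : T -> R) : set_system T :=
  preimage_set_system [set: T] X measurable.

Definition rvec_gen n (X : T -> 'cV[R]_n) : set_system T :=
  \bigcup_(j in [set: 'I_n]) rv_gen (coord X j).

Definition null_sets : set_system T := [set N | measurable N /\ P N = 0%E].

Definition mutually_independent (I : finType) (F : I -> set_system T) : Prop :=
  forall (J : {set I}) (E : I -> set T),
    (forall i, i \in J -> F i (E i)) ->
    P (\bigcap_(i in [set` J]) E i) = (\prod_(i in J) P (E i))%E.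

(* [normal_prob 0 0] is not the degenerate Gaussian but the uniform law on
   [0, 1], hence the case distinction. *)
Definition centered_normal (s : R) : set R -> \bar R :=
  if s == 0 then \d_(0 : R) else normal_prob 0 s.

(* omega(0), ..., omega(Gamma) are N(0, s^2) and, together with the initial
   state beta, mutually independent. *)
Definition white_noise (Gamma : nat) (s : R) n (beta : T -> 'cV[R]_n)
    (omega : nat -> {RV P >-> R}) : Prop :=
  (forall t A, (t <= Gamma)%N -> measurable A ->
     distribution P (omega t) A = centered_normal s A) /\
  mutually_independent (fun k : option 'I_Gamma.+1 =>
    if k is Some t then <<s rv_gen (omega t) >> else <<s rvec_gen beta >>).

(* Generators of F_i(t) = sigma(beta, omega(0), ..., omega(t-i-1)) augmented
   by the null sets; no noise is observed when t <= i. *)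
Definition info n (beta : T -> 'cV[R]_n) (omega : nat -> T -> R)
    (i t : nat) : set_system T :=
  rvec_gen beta `|` \bigcup_(k in [set k | (k + i < t)%N]) rv_gen (omega k)
  `|` null_sets.

End Probability.

(* The suffix b stands for the bar, e.g. cAb is the coefficient of E x. *)
Record mflq (R : realType) (h n : nat) (m : 'I_h.+1 -> nat) := MFLQ {
  cA : 'M[R]_n; cAb : 'M[R]_n;
  cC : 'M[R]_n; cCb : 'M[R]_n;
  cB : forall i, 'M[R]_(n, m i); cBb : forall i, 'M[R]_(n, m i);
  cD : forall i, 'M[R]_(n, m i); cDb : forall i, 'M[R]_(n, m i);
  wQ : 'M[R]_n; wQb : 'M[R]_n;
  wR : forall i, 'M[R]_(m i); wRb : forall i, 'M[R]_(m i);
  wPhi : 'M[R]_n; wPhib : 'M[R]_n }.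

Definition weights_ok (R : realType) (h n : nat) (m : 'I_h.+1 -> nat)
    (L : mflq R n m) : Prop :=
  [/\ [/\ sym (wQ L), sym (wQb L), sym (wPhi L) & sym (wPhib L)],
      (forall i, sym (wR L i) /\ sym (wRb L i)),
      psd (wQ L) /\ psd (wQ L + wQb L),
      (forall i, pd (wR L i) /\ pd (wR L i + wRb L i)) &
      psd (wPhi L) /\ psd (wPhi L + wPhib L)].

Definition control (T : Type) (R : realType) (h : nat) (m : 'I_h.+1 -> nat) :=
  forall i : 'I_h.+1, nat -> T -> 'cV[R]_(m i).

Section MeanFieldLQ.
Context {d : measure_display} {T : measurableType d} {R : realType}.
Variable P : probability T R.
Context {h n : nat} {m : 'I_h.+1 -> nat}.
Variables (L : mflq R n m) (Gamma : nat).
Variables (beta : T -> 'cV[R]_n) (omega : nat -> T -> R).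
Implicit Types u v : control T R m.

Local Notation E := (mean P).
Local Notation F i t := (info P beta omega i t).

Fixpoint state v (t : nat) : T -> 'cV[R]_n :=
  if t is s.+1 then fun w =>
    (cA L *m state v s w + cAb L *m E (state v s)
     + \sum_i (cB L i *m v i s w + cBb L i *m E (v i s)))
    + omega s w *:
      (cC L *m state v s w + cCb L *m E (state v s)
       + \sum_i (cD L i *m v i s w + cDb L i *m E (v i s)))
  else beta.

(* Only the values of v at times t <= Gamma are relevant. *)
Definition cost v : \bar R :=
  (\sum_(t < Gamma.+1)
     'E_P[fun w => (qform (wQ L) (state v t w) + qform (wQb L) (E (state v t))
       + \sum_i (qform (wR L i) (v i t w) + qform (wRb L i) (E (v i t))))%R]
   + 'E_P[fun w => qform (wPhi L) (state v Gamma.+1 w)]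
   + (qform (wPhib L) (E (state v Gamma.+1)))%:E)%E.

Definition initial_control v : Prop :=
  forall (i : 'I_h.+1) t, (t < i)%N ->
    measurable_wrt (F i t) (v i t) /\ square_integrable P (v i t).

(* Square integrability makes all the expectations in the cost finite. *)
Definition admissible v0 v : Prop :=
  (forall (i : 'I_h.+1) t, (t < i)%N -> v i t = v0 i t) /\
  (forall (i : 'I_h.+1) t, (i <= t <= Gamma)%N ->
     measurable_wrt (F i t) (v i t) /\ square_integrable P (v i t)).

Definition solves_problem v0 v : Prop :=
  admissible v0 v /\ forall u, admissible v0 u -> (cost v <= cost u)%E.

Definition At t w : 'M[R]_n := cA L + omega t w *: cC L.
Definition Abt t w : 'M[R]_n := cAb L + omega t w *: cCb L.
Definition Bt i t w : 'M[R]_(n, m i) := cB L i + omega t w *: cD L i.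
Definition Bbt i t w : 'M[R]_(n, m i) := cBb L i + omega t w *: cDb L i.

Definition costate v (theta : nat -> T -> 'cV[R]_n) : Prop :=
  (forall w, theta Gamma w = wPhi L *m state v Gamma.+1 w
                             + wPhib L *m E (state v Gamma.+1)) /\
  (forall t, (1 <= t <= Gamma)%N ->
     exists Z, cond_exp P (F 0%N t) (fun w => (At t w)^T *m theta t w) Z /\
       {ae P, forall w, theta t.-1 w =
          wQ L *m state v t w + wQb L *m E (state v t) + Z w
          + E (fun w' => (Abt t w')^T *m theta t w')}).

Definition equilibrium v (theta : nat -> T -> 'cV[R]_n) : Prop :=
  forall (i : 'I_h.+1) t, (i <= t <= Gamma)%N ->
    exists Z, cond_exp P (F i t) (fun w => (Bt i t w)^T *m theta t w) Z /\
      {ae P, forall w, 0 =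
         wR L i *m v i t w + wRb L i *m E (v i t) + Z w
         + E (fun w' => (Bbt i t w')^T *m theta t w')}.

Definition solves_equilibrium v0 v : Prop :=
  admissible v0 v /\ exists theta, costate v theta /\ equilibrium v theta.

Definition uniquely_solvable (S : control T R m -> Prop) : Prop :=
  exists v, S v /\
    forall u, S u -> forall i t, (t <= Gamma)%N ->
      {ae P, forall w, u i t w = v i t w}.

End MeanFieldLQ.

(* Main.v *)
Require Import Defs.
From HB Require Import structures.
From mathcomp Require Import all_boot all_order all_algebra finmap.
From mathcomp Require Import all_classical all_reals all_analysis.
From mathcomp Require Import measurable_realfun.
From mathcomp Require Import ring lra zify.

(** The problem minimizes a convex quadratic functional over an affine space
    of square-integrable controls, so that a control is optimal exactly when
    the first variation of the cost vanishes in every admissible direction.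
    The equilibrium condition is that stationarity condition, with the first
    variation expressed through the costate.  Hence the two problems have the
    same solutions ([optimal_equilibrium], [equilibrium_optimal]), and unique
    solvability of one is unique solvability of the other.

    Perturbing a control v to v + e dv moves the state by e y, where y is the
    state driven by dv from the origin, because the dynamics is linear.  The
    cost becomes J(v) + 2 e D + e^2 J0, where J0 is the cost of dv started
    from the origin; J0 >= 0 because the expectation of a quadratic form is at
    least its value at the expectation ([mean_form_ge0]).  The costate turns D
    into a sum over the times t and the controllers i.  The backward iteration
    says that E<theta(t-1), y(t)> is E<Q x + Qbar E x, y> plus
    E<theta(t), A(t) y + Abar(t) E y>, so that E<theta(t), y(t+1)> telescopes
    and only the contributions of the controls remain
    ([cost_polar_gradient]).  Each of them is the pairing of dv_i(t) with the
    right-hand side of the equilibrium condition.  It is zero when the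
    condition holds; conversely, testing with the indicators of the sets of
    the information sigma-algebra ([probe]) identifies the conditional
    expectation that the condition requires.

    Most of the work is measure-theoretic.  The costate exists because
    conditional expectations do, by the Radon-Nikodym theorem
    ([ex_cond_exp_scalar]).  All the pairings above must be finite, which asks
    for a square-integrable costate, although theta(t) gets multiplied by the
    unbounded noise omega(t) before it is conditioned.  Now omega(t) is
    independent of the information available at time t ([info_indep]), so that
    multiplication by omega(t) preserves square integrability of the variables
    known at time t ([L2_mul_indep]); testing against such variables, the
    conditional expectation of omega(t) theta(t) is square integrable as soon
    as theta(t) is ([cond_exp_L2]).  A costate is only constrained almost surely, hence may
    fail to be measurable; it is replaced by a square-integrable modification
    ([costate_modification]), which is harmless because integrals do not see
    null sets even for non-measurable functions ([integral_ae_congr]). *)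

Set Implicit Arguments.
Unset Strict Implicit.
Unset Printing Implicit Defensive.

Import Order.TTheory GRing.Theory Num.Theory.
Import numFieldNormedType.Exports.
(* The coordinate functions of linear algebra would otherwise hide [coord]. *)
Import Defs.

Local Open Scope classical_set_scope.
Local Open Scope ring_scope.

(** * Integrals and null sets *)

Section ae_integral.
Context {d : measure_display} {T : measurableType d} {R : realType}.
Variable P : {measure set T -> \bar R}.
Local Open Scope ereal_scope.

Import HBNNSimple.

(** The integral of a nonnegative function is a supremum over the simple
    functions below it.  Killing such a simple function on a null set does not
    change its integral and puts it below g.  Only simple functions have to be
    measurable, so this covers costates, which are only known almost surely. *)
Lemma ge0_le_integral_off_null (f g : T -> \bar R) (N : set T) :
  measurable N -> P N = 0 ->
  (forall x, 0 <= f x) -> (forall x, 0 <= g x) ->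
  (forall x, ~ N x -> f x = g x) ->
  \int[P]_x f x <= \int[P]_x g x.
Proof.
move=> mN N0 f0 g0 fg.
rewrite ge0_integralTE//; apply: ge_ereal_sup => /= _ [s sf <-].
have mNc : measurable (~` N) by exact: measurableC.
rewrite -integralT_nnsfun.
have -> : \int[P]_x (s x)%:E = \int[P]_x ((s x * \1_(~` N) x)%R)%:E.
  apply: ge0_ae_eq_integral => //.
  - exact/measurable_EFinP.
  - by apply/measurable_EFinP; apply: measurable_funM => //.
  - by move=> x _; rewrite lee_fin.
  - by move=> x _; rewrite lee_fin mulr_ge0.
  exists N; split => // x /= /not_implyP[_ h].
  apply: contrapT => Nx; apply: h.
  by rewrite indicE mem_set// mulr1.
rewrite [leRHS]ge0_integralTE//.
apply: ereal_sup_ubound => /=.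
exists (mul_nnsfun s (indic_nnsfun R mNc)); last first.
  by rewrite -integralT_nnsfun.
move=> x.
rewrite (_ : mul_nnsfun s _ x = s x * \1_(~` N) x)%R// indicE.
have [Nx|Nx] := boolP (x \in ~` N).
  by rewrite mulr1 -fg//; exact: (set_mem Nx).
by rewrite mulr0.
Qed.

Lemma integral_ae_congr (f g : T -> \bar R) :
  {ae P, forall x, f x = g x} -> \int[P]_x f x = \int[P]_x g x.
Proof.
move=> [N [mN N0 sN]].
have fg x : ~ N x -> f x = g x.
  by move=> Nx; apply: contrapT => h; apply: Nx; apply: sN.
rewrite integralE [RHS]integralE; congr (_ - _); apply/eqP; rewrite eq_le;
  apply/andP; split; apply: (ge0_le_integral_off_null mN N0) => //;
  by move=> x Nx; rewrite ?funeposE ?funenegE fg.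
Qed.

End ae_integral.

(** * Sub-sigma-algebras, conditional expectation and independence *)

Section sub_sigma_algebra.
Context {d : measure_display} {T : measurableType d} {R : realType}.
Variable P : probability T R.
Variable G : set_system T.
Hypothesis mG : forall A, G A -> measurable A.

Local Notation GT := (g_sigma_algebraType G).

Lemma g_sigma_measurable A : <<s G >> A -> measurable A.
Proof.
move: A; apply: smallest_sub; last exact: mG.
by have := @sigma_algebra_measurable _ T.
Qed.

Lemma sub_measurable_fun d' (U : measurableType d') (f : T -> U) :
  measurable_fun [set: GT] (f : GT -> U) -> measurable_fun [set: T] f.
Proof.
move=> mf _ B mB; apply: g_sigma_measurable.
exact: (mf measurableT B mB).
Qed.

(** The identity, seen as a measurable map into the coarser measurable space:
    the law of this map is the restriction of P to the sub-sigma-algebra. *)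
Definition sub_id (w : T) : GT := w.

Lemma measurable_sub_id : measurable_fun [set: T] sub_id.
Proof.
move=> _ B mB; rewrite setTI; exact: g_sigma_measurable.
Qed.

HB.instance Definition _ := isMeasurableFun.Build _ _ _ _ sub_id measurable_sub_id.

Local Notation PG := (distribution P sub_id).

Local Open Scope ereal_scope.

Lemma integral_sub (f : T -> \bar R) :
  measurable_fun [set: GT] (f : GT -> \bar R) ->
  (forall x, 0 <= f x) -> \int[PG]_x f x = \int[P]_x f x.
Proof.
move=> mf f0; rewrite ge0_integral_distribution//.
Qed.

(** The density, with respect to the restriction of P, of the charge that
    integrates X over the sets of the sub-sigma-algebra. *)
Lemma ex_cond_exp_scalar (X : T -> R) :
  P.-integrable [set: T] (EFin \o X) ->
  exists Z : T -> R,
  [/\ measurable_fun [set: GT] (Z : GT -> R),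
      P.-integrable [set: T] (EFin \o Z) &
      forall A, <<s G >> A -> \int[P]_(w in A) (Z w)%:E = \int[P]_(w in A) (X w)%:E].
Proof.
move=> iX.
pose nu : {charge set T -> \bar R} := induced_charge iX.
have [nuG nuGE] : exists nuG : {charge set GT -> \bar R},
    forall A, nuG A = \int[P]_(w in A) (X w)%:E.
  by unshelve eexists (pushforward nu sub_id); first exact: measurable_sub_id.
have dom : nuG `<< PG.
  apply/null_content_dominatesP => A mA PA0.
  rewrite nuGE.
  have mA' : measurable (A : set T) by exact: g_sigma_measurable.
  apply: null_set_integral => //.
  exact: measurable_funTS (measurable_int _ iX).
have ff x := Radon_Nikodym_fin_num x dom.
have iRN := Radon_Nikodym_integrable dom.
have iE A mA := @Radon_Nikodym_integral _ _ _ nuG PG A dom mA.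
move: (Radon_Nikodym nuG PG) ff iRN iE => f ff iRN iE.
have mf := measurable_int _ iRN.
have fE : EFin \o (fine \o f) = f by apply/funext => x /=; rewrite fineK.
exists (fine \o f); split.
- exact: measurableT_comp.
- rewrite fE; apply/integrableP; split; first exact: sub_measurable_fun.
  move/integrableP : iRN => [_]; apply: le_lt_trans.
  rewrite integral_sub//; exact: measurableT_comp.
- move=> A GA.
  rewrite -nuGE iE// integral_pushforward//=.
  + by apply: eq_integral => x _; rewrite -[in RHS]fE.
  + apply: (integrableS measurableT) => //.
      exact: g_sigma_measurable.
    apply/integrableP; split; first exact: sub_measurable_fun.
    move/integrableP : iRN => [_]; apply: le_lt_trans.
    rewrite integral_sub//; exact: measurableT_comp.
Qed.

Section independent_variable.
Variable W : {RV P >-> R}.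
Hypothesis indep : forall A B, <<s G >> A -> measurable B ->
  P (A `&` W @^-1` B) = P A * P (W @^-1` B).

(** Independence says that the law of this pair is a product measure. *)
Definition sub_pair (w : T) : GT * R := (sub_id w, W w).

Lemma measurable_sub_pair : measurable_fun [set: T] sub_pair.
Proof.
apply: measurable_fun_pair => //; exact: measurable_sub_id.
Qed.

HB.instance Definition _ :=
  isMeasurableFun.Build _ _ _ _ sub_pair measurable_sub_pair.

Lemma integral_mul_indep (f : T -> R) (g : R -> R) :
  measurable_fun [set: GT] (f : GT -> R) -> measurable_fun [set: R] g ->
  (forall w, (0 <= f w)%R) -> (forall r, (0 <= g r)%R) ->
  \int[P]_w (f w * g (W w))%:E = (\int[P]_w (f w)%:E) * (\int[P]_w (g (W w))%:E).
Proof.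
move=> mf mg f0 g0.
pose F (z : GT * R) := (f z.1 * g z.2)%:E.
have F0 z : 0 <= F z by rewrite lee_fin mulr_ge0.
have mF : measurable_fun [set: GT * R] F.
  apply/measurable_EFinP/measurable_funM.
  - exact: (measurableT_comp mf).
  - exact: (measurableT_comp mg).
have -> : \int[P]_w (f w * g (W w))%:E = \int[distribution P sub_pair]_z F z.
  by rewrite ge0_integral_distribution.
rewrite (eq_measure_integral (PG \x (distribution P W))%E); last first.
  move=> A mA _; apply/esym.
  exact: (product_measure_unique (m' := distribution P sub_pair)).
rewrite fubini_tonelli1//=.
transitivity (\int[PG]_x ((f x)%:E * \int[distribution P W]_y (g y)%:E)).
  apply: eq_integral => x _; rewrite /fubini_F /F /=.
  under eq_integral do rewrite EFinM.
  rewrite ge0_integralZl//=.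
  - exact/measurable_EFinP.
  - by move=> y _; rewrite lee_fin.
  - by rewrite lee_fin.
rewrite ge0_integralZr//=.
- rewrite [in X in _ * X]ge0_integral_distribution//.
  + congr (_ * _); rewrite (integral_sub (f := EFin \o f))//.
      exact/measurable_EFinP.
  + exact/measurable_EFinP.
- exact/measurable_EFinP.
- by move=> x _; rewrite lee_fin.
- by apply: integral_ge0 => x _; rewrite lee_fin.
Qed.

End independent_variable.

End sub_sigma_algebra.

(** * Second moment of the Gaussian law *)

Section normal_moment.
Context {R : realType}.
Local Notation mu := (@lebesgue_measure R).
Local Open Scope ereal_scope.

Lemma ge0_integral_normal_prob (s : R) (f : R -> \bar R) :
  measurable_fun [set: R] f -> (forall x, 0 <= f x) ->
  \int[normal_prob 0 s]_x f x = \int[mu]_x (f x * (normal_pdf 0 s x)%:E).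
Proof.
move=> mf f0.
have dom := @normal_prob_dominates R 0 s.
rewrite -(Radon_Nikodym_SigmaFinite.change_of_variables dom)//.
apply: ae_eq_integral => //.
- apply: emeasurable_funM => //.
  exact: (measurable_int _ (Radon_Nikodym_SigmaFinite.f_integrable dom)).
- apply: emeasurable_funM => //; apply/measurable_EFinP.
  exact: measurable_normal_pdf.
apply: ae_eqe_mul2l; apply: integral_ae_eq => //.
- exact: Radon_Nikodym_SigmaFinite.f_integrable.
- by apply/measurable_EFinP; exact: measurable_normal_pdf.
- by move=> E _ mE; rewrite -Radon_Nikodym_SigmaFinite.f_integral.
Qed.

(** The factor x^2 is absorbed by doubling the standard deviation: x^2 times
    the density of N(0, s^2) is at most a constant times the density of
    N(0, 4 s^2), which has mass 1. *)
Lemma normal_moment2 (s : R) : s != 0%R ->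
  \int[normal_prob 0 s]_x (x ^+ 2)%:E < +oo.
Proof.
move=> s0.
rewrite ge0_integral_normal_prob; last 2 first.
- by apply/measurable_EFinP; exact: measurable_funX.
- by move=> x; rewrite lee_fin sqr_ge0.
pose r := (2 * s)%R.
have r0 : r != 0%R by rewrite mulf_neq0.
have pr := normal_peak_gt0 r0.
pose c := (normal_peak s * (normal_peak r)^-1 * (4 * s ^+ 2))%R.
have s2 : (0 < s ^+ 2)%R by rewrite exprn_even_gt0.
apply: (@le_lt_trans _ _ (\int[mu]_x (c%:E * (normal_pdf 0 r x)%:E))).
  apply: ge0_le_integral => //.
  - by move=> x _; rewrite lee_fin mulr_ge0 ?sqr_ge0 ?normal_pdf_ge0.
  - apply/measurable_EFinP/measurable_funM; first exact: measurable_funX.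
    exact: measurable_normal_pdf.
  - apply/measurable_EFinP/measurable_funM => //; exact: measurable_normal_pdf.
  move=> x _; rewrite -EFinM lee_fin !normal_pdfE// /normal_fun !subr0.
  set y := (x ^+ 2 / s ^+ 2)%R.
  have -> : (x ^+ 2 = 4 * s ^+ 2 * (y / 4))%R by rewrite /y; field.
  have -> : (- (4 * s ^+ 2 * (y / 4)) / (s ^+ 2 *+ 2) = - (y / 2))%R by field.
  have -> : (- (4 * s ^+ 2 * (y / 4)) / (r ^+ 2 *+ 2) = - (y / 2) + 3 * y / 8)%R.
    by rewrite /r; field.
  rewrite expRD.
  have y0 : (0 <= y)%R by rewrite divr_ge0 ?sqr_ge0.
  have ye : (y / 4 <= expR (3 * y / 8))%R.
    by apply: le_trans (expR_ge1Dx _); lra.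
  have -> : (c * (normal_peak r * (expR (- (y / 2)) * expR (3 * y / 8))) =
    4 * s ^+ 2 * (normal_peak s * expR (- (y / 2))) * expR (3 * y / 8))%R.
    by rewrite /c; field; rewrite gt_eqF.
  have -> : (4 * s ^+ 2 * (y / 4) * (normal_peak s * expR (- (y / 2))) =
    4 * s ^+ 2 * (normal_peak s * expR (- (y / 2))) * (y / 4))%R by ring.
  apply: ler_wpM2l => //.
  by apply: mulr_ge0; apply: mulr_ge0; rewrite ?sqr_ge0 ?normal_peak_ge0 ?expR_ge0.
rewrite integralZl//; last exact: integrable_normal_pdf.
by rewrite integral_normal_pdf mule1 ltry.
Qed.

End normal_moment.

(** * Pulling a known factor out of a conditional expectation *)

Section pull_out.
Context {d : measure_display} {T : measurableType d} {R : realType}.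
Variable P : probability T R.
Variable G : set_system T.
Hypothesis mG : forall A, G A -> measurable A.
Local Notation GT := (g_sigma_algebraType G).
Variable D : T -> R.
Hypothesis iD : P.-integrable [set: T] (EFin \o D).
Hypothesis D0 : forall A, <<s G >> A -> (\int[P]_(w in A) (D w)%:E = 0)%E.

Import HBNNSimple.
Local Open Scope ereal_scope.

Let mD : measurable_fun [set: T] D.
Proof. exact/measurable_EFinP/(measurable_int _ iD). Qed.

(** By linearity from indicators, for which it is the hypothesis on D. *)
Let integral_nnsfun_mul0 (s : {nnsfun GT >-> R}) :
  \int[P]_w (s w * D w)%:E = 0.
Proof.
have ms : measurable_fun [set: GT] s by [].
pose S r : set T := s @^-1` [set r].
have GA r : <<s G >> (S r).
  by have := ms measurableT _ (measurable_set1 r); rewrite setTI.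
have mA r : measurable (S r).
  exact: (g_sigma_measurable mG).
have i1 r : P.-integrable setT (fun w : T => (\1_(S r) w * D w)%:E).
  apply: le_integrable iD => //.
    apply/measurable_EFinP; apply: measurable_funM => //.
  move=> x _ /=; rewrite lee_fin normrM ler_piMl// indicE.
  by case: (x \in _); rewrite /= ?normr1 ?normr0.
transitivity (\int[P]_w (\sum_(r <- fset_set (range s))
     r%:E * (\1_(S r) w * D w)%:E)).
  apply: eq_integral => w _; rewrite [in LHS](fimfunE s w) fsbig_finite//=.
  rewrite mulr_suml -sumEFin; apply: eq_bigr => r _.
  by rewrite -EFinM mulrA.
rewrite integral_sum//=; last by move=> r; apply: integrableZl.
apply: big1 => r _; rewrite integralZl//.
rewrite [X in _ * X](_ : _ = 0) ?mule0//.
rewrite -(@D0 (S r)).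
  rewrite [RHS]integral_mkcond; apply: eq_integral => w _.
  by rewrite epatch_indic /= EFinM muleC.
exact: GA.
Qed.

(** Simple functions increasing to x are dominated by x, so the products with
    D are dominated by the integrable function |x D|. *)
Let pull_out_ge0 (x : T -> R) : measurable_fun [set: GT] (x : GT -> R) ->
  (forall w, (0 <= x w)%R) ->
  P.-integrable [set: T] (fun w => (x w * D w)%:E) ->
  \int[P]_w (x w * D w)%:E = 0.
Proof.
move=> mx x0 ixD.
have mEx : measurable_fun [set: GT] (EFin \o x : GT -> \bar R).
  exact/measurable_EFinP.
pose h := nnsfun_approx (@measurableT _ GT) mEx.
have hx w : EFin \o h ^~ w @ \oo --> (x w)%:E.
  apply: (@cvg_nnsfun_approx _ GT R setT measurableT _ mEx) => //.
  by move=> ? _; rewrite lee_fin.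
have hle n w : (h n w <= x w)%R.
  rewrite -lee_fin.
  have ndh : nondecreasing_seq (EFin \o h ^~ w).
    by move=> a b ab; rewrite lee_fin; exact/lefP/nd_nnsfun_approx.
  rewrite (cvg_unique _ (hx w) (ereal_nondecreasing_cvgn ndh))//.
  by apply: ereal_sup_ubound; exists n.
have mh n : measurable_fun [set: T] (h n : T -> R).
  exact: (sub_measurable_fun mG).
have [||_ _] := @dominated_convergence _ T R P setT measurableT
  (fun n w => (h n w * D w)%:E) (fun w => (x w * D w)%:E)
  (fun w => `|(x w * D w)%:E|)
  (fun n => (measurable_EFinP _ _).2 (measurable_funM (mh n) mD))
  (measurable_int _ ixD) _ (integrable_abse ixD) _.
- apply: aeW => w _; rewrite EFinM.
  have Dfin : (D w)%:E \is a fin_num by [].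
  exact: (cvgeZr Dfin (hx w)).
- apply: aeW => w n _ /=; rewrite lee_fin !normrM ler_wpM2r//.
  by rewrite !ger0_norm ?x0//.
rewrite (_ : (fun n => \int[P]_w (h n w * D w)%:E) = fun=> 0); last first.
  by apply/funext => n; exact: integral_nnsfun_mul0.
by move=> H; apply/esym/(cvg_unique _ (cvg_cst _) H).
Qed.

(** Applied to D = Z - X with Z a conditional expectation of X: this is how Z
    replaces X against any x known to the sub-sigma-algebra. *)
Lemma integral_mul_eq0 (x : T -> R) : measurable_fun [set: GT] (x : GT -> R) ->
  P.-integrable [set: T] (fun w => (x w * D w)%:E) ->
  \int[P]_w (x w * D w)%:E = 0.
Proof.
move=> mx ixD.
pose xp w := Num.max (x w) 0%R; pose xn w := Num.max (- x w)%R 0%R.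
have mxp : measurable_fun [set: GT] (xp : GT -> R).
  by apply: measurable_maxr => //.
have mxn : measurable_fun [set: GT] (xn : GT -> R).
  by apply: measurable_maxr => //; exact: measurableT_comp.
have ixp : P.-integrable [set: T] (fun w => (xp w * D w)%:E).
  apply: le_integrable ixD => //.
    by apply/measurable_EFinP/measurable_funM => //; exact: (sub_measurable_fun mG).
  move=> w _; rewrite lee_fin !normrM ler_wpM2r// /xp.
  by case: (leP (x w) 0%R) => // ?; rewrite normr0.
have ixn : P.-integrable [set: T] (fun w => (xn w * D w)%:E).
  apply: le_integrable ixD => //.
    by apply/measurable_EFinP/measurable_funM => //; exact: (sub_measurable_fun mG).
  move=> w _; rewrite lee_fin !normrM ler_wpM2r// /xn.
  by case: (leP (- x w)%R 0%R) => // ?; rewrite ?normr0 ?normrN.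
transitivity (\int[P]_w ((xp w * D w)%:E - (xn w * D w)%:E)).
  apply: eq_integral => w _; rewrite -EFinB -mulrBl; congr (_ * _)%:E.
  by rewrite /xp /xn; case: (leP (x w) 0%R); case: (leP (- x w)%R 0%R); lra.
rewrite integralB// !pull_out_ge0 ?sube0// => w; rewrite /xp /xn le_max lexx orbT//.
Qed.

End pull_out.

(** * Square-integrable random variables *)

Section square_integrable_functions.
Context {d : measure_display} {T : measurableType d} {R : realType}.
Variable P : probability T R.
Local Notation L1 := (Lfun P 1).
Local Notation L2 := (Lfun P 2%:E).
Implicit Types f g : T -> R.

Definition rmean f : R := fine ('E_P[f])%E.

Lemma rmeanE f : f \in L1 -> (rmean f)%:E = ('E_P[f])%E.
Proof. by move=> f1; rewrite /rmean fineK// expectation_fin_num. Qed.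

Lemma L1_integrable f : f \in L1 -> P.-integrable [set: T] (EFin \o f).
Proof. by move/Lfun1_integrable. Qed.

Lemma integrable_L1 f : P.-integrable [set: T] (EFin \o f) -> f \in L1.
Proof. by move=> ?; apply/Lfun1_integrable. Qed.

Lemma L1_measurable f : f \in L1 -> measurable_fun [set: T] f.
Proof. by move=> /L1_integrable/(measurable_int _)/measurable_EFinP. Qed.

Lemma L1D f g : f \in L1 -> g \in L1 -> (fun w => f w + g w) \in L1.
Proof. exact: rpredD. Qed.

Lemma L1_sum I (r : seq I) (F : I -> T -> R) :
  (forall i, F i \in L1) -> (fun w => \sum_(i <- r) F i w) \in L1.
Proof.
move=> F1; rewrite (_ : (fun w => _) = \sum_(i <- r) F i); last first.
  by apply/funext => w; rewrite fct_sumE.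
by apply: rpred_sum => i _; exact: F1.
Qed.

Lemma L1Z a f : f \in L1 -> (fun w => a * f w) \in L1.
Proof.
move=> f1; rewrite (_ : (fun w => _) = a \o* f); last first.
  by apply/funext => w /=; rewrite mulrC.
exact: (Lfun_scale a (lexx _) f1).
Qed.

Lemma L1_cst a : (fun=> a) \in L1.
Proof. exact: (Lfun_cst P a 1). Qed.

Lemma L2_L1 f : f \in L2 -> f \in L1.
Proof. by apply: Lfun_subset12; rewrite fin_num_measure. Qed.

Lemma L2_measurable f : f \in L2 -> measurable_fun [set: T] f.
Proof. by move/L2_L1/L1_measurable. Qed.

Lemma L2M f g : f \in L2 -> g \in L2 -> (fun w => f w * g w) \in L1.
Proof. exact: Lfun2_mul_Lfun1. Qed.

Lemma integral_sqr_L2 f : measurable_fun [set: T] f ->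
  (\int[P]_w (f w ^+ 2)%:E < +oo)%E -> f \in L2.
Proof.
move=> mf If; rewrite inE; apply/andP; split; rewrite inE/=//.
rewrite /finite_norm unlock poweR_lty//=.
by under eq_integral do rewrite powR_mulrn// real_normK ?num_real//.
Qed.

Lemma L2_integral_sqr f : f \in L2 -> (\int[P]_w (f w ^+ 2)%:E < +oo)%E.
Proof.
move=> /Lfun2_integrable_sqr/integrableP[_].
by under eq_integral do rewrite /= ger0_norm ?sqr_ge0//.
Qed.

Lemma L2D f g : f \in L2 -> g \in L2 -> (fun w => f w + g w) \in L2.
Proof. exact: (Lfun_addr_closed P (lee1n 2)).2. Qed.

Lemma L2Z a f : f \in L2 -> (fun w => a * f w) \in L2.
Proof.
move=> f1; rewrite (_ : (fun w => _) = a \o* f); last first.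
  by apply/funext => w /=; rewrite mulrC.
by apply: Lfun_scale => //; rewrite ler1n.
Qed.

Lemma L2_cst a : (fun=> a) \in L2.
Proof. exact: (Lfun_cst P a 2). Qed.

Lemma L2_sum I (r : seq I) (F : I -> T -> R) :
  (forall i, F i \in L2) -> (fun w => \sum_(i <- r) F i w) \in L2.
Proof.
move=> F1; elim: r => [|i r IH].
  by under eq_fun do rewrite big_nil; exact: L2_cst.
by under eq_fun do rewrite big_cons; exact: L2D.
Qed.

Lemma rmeanD f g : f \in L1 -> g \in L1 ->
  rmean (fun w => f w + g w) = rmean f + rmean g.
Proof.
move=> f1 g1; apply: EFin_inj; rewrite EFinD !rmeanE//; last exact: L1D.
exact: expectationD.
Qed.

Lemma rmeanZ a f : f \in L1 -> rmean (fun w => a * f w) = a * rmean f.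
Proof.
move=> f1; apply: EFin_inj; rewrite EFinM !rmeanE//; last exact: L1Z.
rewrite -expectationZl//; congr expectation.
by apply/funext => w /=; rewrite mulrC.
Qed.

Lemma rmean_cst a : rmean (fun=> a) = a.
Proof. by apply: EFin_inj; rewrite rmeanE ?L1_cst//; exact: expectation_cst. Qed.

Lemma rmean_sum I (r : seq I) (F : I -> T -> R) :
  (forall i, F i \in L1) ->
  rmean (fun w => \sum_(i <- r) F i w) = \sum_(i <- r) rmean (F i).
Proof.
move=> F1; elim: r => [|i r IH].
  by under eq_fun do rewrite big_nil; rewrite big_nil rmean_cst.
under eq_fun do rewrite big_cons.
by rewrite big_cons rmeanD ?IH//; exact: L1_sum.
Qed.

Lemma rmean_ge0 f : (forall w, 0 <= f w) -> 0 <= rmean f.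
Proof. by move=> f0; rewrite fine_ge0// expectation_ge0. Qed.

Lemma rmean_le f g : f \in L1 -> g \in L1 -> (forall w, f w <= g w) ->
  rmean f <= rmean g.
Proof.
move=> f1 g1 fg; rewrite -subr_ge0 -mulN1r -rmeanZ// -rmeanD//; last exact: L1Z.
by apply: rmean_ge0 => w; rewrite mulN1r subr_ge0.
Qed.

Lemma rmean_ae f g : {ae P, forall w, f w = g w} -> rmean f = rmean g.
Proof.
move=> fg; rewrite /rmean unlock; congr fine; apply: integral_ae_congr.
by apply: filterS fg => w ->.
Qed.

End square_integrable_functions.

Section independent_square_integrable.
Context {d : measure_display} {T : measurableType d} {R : realType}.
Variable P : probability T R.
Local Notation L1 := (Lfun P 1).
Local Notation L2 := (Lfun P 2%:E).
Variable G : set_system T.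
Hypothesis mG : forall A, G A -> measurable A.
Local Notation GT := (g_sigma_algebraType G).
Variable W : {RV P >-> R}.
Hypothesis indep : forall A B, <<s G >> A -> measurable B ->
  P (A `&` W @^-1` B) = (P A * P (W @^-1` B))%E.
Hypothesis W2 : (W : T -> R) \in L2.

Lemma integral_sqr_indep (x : T -> R) : measurable_fun [set: GT] (x : GT -> R) ->
  (\int[P]_w ((W w * x w) ^+ 2)%:E =
   (\int[P]_w (x w ^+ 2)%:E) * (\int[P]_w (W w ^+ 2)%:E))%E.
Proof.
move=> mx.
rewrite -(integral_mul_indep mG indep (f := fun w => x w ^+ 2)
   (g := fun r => r ^+ 2)).
- by apply: eq_integral => w _; rewrite exprMn mulrC.
- exact: (@measurable_funX _ GT).
- exact: measurable_funX.
- by move=> w; exact: sqr_ge0.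
- by move=> w; exact: sqr_ge0.
Qed.

Lemma L2_mul_indep (x : T -> R) : measurable_fun [set: GT] (x : GT -> R) ->
  x \in L2 -> (fun w => W w * x w) \in L2.
Proof.
move=> mx x2; apply: integral_sqr_L2.
  apply: measurable_funM => //; exact: L2_measurable x2.
rewrite integral_sqr_indep//.
rewrite lte_mul_pinfty ?L2_integral_sqr//.
  by apply: integral_ge0 => w _; rewrite lee_fin sqr_ge0.
rewrite ge0_fin_numE ?L2_integral_sqr//.
by apply: integral_ge0 => w _; rewrite lee_fin sqr_ge0.
Qed.

Variables a b Z : T -> R.
Hypotheses (a2 : a \in L2) (b2 : b \in L2) (Z1 : Z \in L1).
Hypothesis mZ : measurable_fun [set: GT] (Z : GT -> R).
Let X w := a w + W w * b w.
Hypothesis ZX : forall A, <<s G >> A ->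
  (\int[P]_(w in A) (Z w)%:E = \int[P]_(w in A) (X w)%:E)%E.

Let kappa := rmean P (fun w => W w ^+ 2).

Let X1 : X \in L1.
Proof. by apply: L1D; [exact: L2_L1|exact: L2M]. Qed.

(** Truncation of Z: bounded, hence a legitimate test function before Z is
    known to be square integrable. *)
Let z (n : nat) w := if `|Z w| <= n%:R then Z w else 0.

Let mz n : measurable_fun [set: GT] (z n : GT -> R).
Proof.
apply: measurable_fun_if => //=.
- apply: measurable_fun_ler => //.
  exact: measurableT_comp.
- exact: measurable_funTS.
Qed.

Let z_le n w : `|z n w| <= n%:R.
Proof. by rewrite /z; case: ifPn => // _; rewrite normr0. Qed.

Let z2 n : z n \in L2.
Proof.
apply: integral_sqr_L2; first exact: (sub_measurable_fun mG).
apply: (@le_lt_trans _ _ (\int[P]_w (n%:R ^+ 2 : R)%:E)%E).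
  apply: ge0_le_integral => //.
  - by move=> w _; rewrite lee_fin sqr_ge0.
  - apply/measurable_EFinP/measurable_funX; exact: (sub_measurable_fun mG).
  - by move=> w _; rewrite lee_fin -(@real_normK _ (z n w)) ?num_real// lerXn2r// nnegrE.
by rewrite integral_cst//= probability_setT mule1 ltry.
Qed.

Let kappa_ge0 : 0 <= kappa.
Proof. by apply: rmean_ge0 => w; exact: sqr_ge0. Qed.

Let z_mul_bound n : rmean P (fun w => (W w * z n w) ^+ 2) =
  kappa * rmean P (fun w => z n w ^+ 2).
Proof.
apply: EFin_inj; rewrite EFinM rmeanE; last first.
  by apply: L2M; apply: L2_mul_indep.
rewrite !rmeanE; [|exact: L2M..].
by rewrite unlock integral_sqr_indep// muleC.
Qed.

Let K := 2 * (rmean P (fun w => a w ^+ 2) + (kappa + 1) * rmean P (fun w => b w ^+ 2)).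

(** As z_n is known to the sub-sigma-algebra, E z_n^2 = E z_n Z = E z_n X.
    The arithmetic-geometric inequality bounds z_n X by
    z_n^2 / 4 + (W z_n)^2 / (4 (kappa + 1)) plus terms in a and b, and by
    independence these two summands have expectation at most E z_n^2 / 2,
    which is absorbed by the left-hand side. *)
Let z_bound n : rmean P (fun w => z n w ^+ 2) <= K.
Proof.
have k0 : 0 < kappa + 1 by rewrite ltr_wpDl.
have zX : rmean P (fun w => z n w ^+ 2) = rmean P (fun w => z n w * X w).
  have -> : rmean P (fun w => z n w ^+ 2) = rmean P (fun w => z n w * Z w).
    congr rmean; apply/funext => w; rewrite /z expr2; case: ifP => //.
    by rewrite !mul0r.
  have i1 : P.-integrable [set: T] (fun w => (z n w * Z w)%:E).
    apply: (L1_integrable (f := fun w => z n w * Z w)).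
    rewrite (_ : (fun w => _) = fun w => z n w * z n w); first exact: L2M.
    by apply/funext => w; rewrite /z; case: ifP => // _; rewrite !mul0r.
  have i2 : P.-integrable [set: T] (fun w => (z n w * X w)%:E).
    apply: (@le_integrable _ _ _ _ _ _ _ (fun w => (n%:R * X w)%:E)) => //.
    - apply/measurable_EFinP/measurable_funM; last exact: L1_measurable X1.
      exact: (sub_measurable_fun mG).
    - move=> w _; rewrite lee_fin !normrM ler_wpM2r//.
      by rewrite (ger0_norm (ler0n _ _)).
    - exact: L1_integrable (L1Z _ X1).
  have iZ := L1_integrable Z1; have iX := L1_integrable X1.
  have i3 : P.-integrable [set: T] (fun w => (z n w * (Z w - X w))%:E).
    rewrite (_ : (fun w => _) = (fun w => (z n w * Z w)%:E) \-
        (fun w => (z n w * X w)%:E))%E; first exact: integrableB.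
    by apply/funext => w; rewrite /= -EFinB mulrBr.
  have i0 : (\int[P]_w (z n w * (Z w - X w))%:E = 0)%E.
    apply: (integral_mul_eq0 mG) => //.
    - rewrite (_ : EFin \o _ = (EFin \o Z) \- (EFin \o X))%E//.
      exact: integrableB.
    - move=> A GA; have mA := g_sigma_measurable mG GA.
      under eq_integral do rewrite EFinB.
      rewrite integralB//=; [|exact: (integrableS measurableT)..].
      rewrite ZX// subee// integrable_fin_num//=.
      exact: (integrableS measurableT).
  have zZ1 := integrable_L1 i1; have zX1 := integrable_L1 i2.
  apply/eqP; rewrite -subr_eq0 -mulN1r -rmeanZ// -rmeanD//; last exact: L1Z.
  rewrite (_ : (fun w => _) = fun w => z n w * (Z w - X w)); last first.
    by apply/funext => w; rewrite mulN1r mulrBr.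
  by rewrite /rmean unlock i0.
have le1 w : z n w * X w <= 4^-1 * z n w ^+ 2 + (a w ^+ 2 +
     ((4 * (kappa + 1))^-1 * (W w * z n w) ^+ 2 + (kappa + 1) * b w ^+ 2)).
  rewrite -subr_ge0.
  have -> : 4^-1 * z n w ^+ 2 + (a w ^+ 2 +
      ((4 * (kappa + 1))^-1 * (W w * z n w) ^+ 2 + (kappa + 1) * b w ^+ 2)) -
      z n w * X w = (z n w / 2 - a w) ^+ 2 +
      (kappa + 1) * (W w * z n w / (2 * (kappa + 1)) - b w) ^+ 2.
    by rewrite /X; field; rewrite gt_eqF.
  apply: addr_ge0; first exact: sqr_ge0.
  by apply: mulr_ge0; [exact: ltW|exact: sqr_ge0].
have zz1 : (fun w => z n w ^+ 2) \in L1 by exact: L2M.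
have aa1 : (fun w => a w ^+ 2) \in L1 by exact: L2M.
have bb1 : (fun w => b w ^+ 2) \in L1 by exact: L2M.
have Wz1 : (fun w => (W w * z n w) ^+ 2) \in L1.
  by apply: L2M; apply: L2_mul_indep.
have zX1 : (fun w => z n w * X w) \in L1.
  rewrite (_ : (fun w => _) = fun w => z n w * a w + (W w * z n w) * b w).
    by apply: L1D; apply: L2M => //; apply: L2_mul_indep.
  by apply/funext => w; rewrite /X; ring.
have := rmean_le zX1 _ le1.
rewrite -zX !rmeanD ?rmeanZ//; try by do ?[apply: L1D|apply: L1Z].
rewrite z_mul_bound => H.
have /H {H} : (fun w => 4^-1 * z n w ^+ 2 + (a w ^+ 2 +
     ((4 * (kappa + 1))^-1 * (W w * z n w) ^+ 2 + (kappa + 1) * b w ^+ 2))) \in L1.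
  by do ?[apply: L1D|apply: L1Z].
rewrite /K; set S := rmean P (fun w => z n w ^+ 2).
have S0 : 0 <= S by apply: rmean_ge0 => w; exact: sqr_ge0.
have : (4 * (kappa + 1))^-1 * (kappa * S) <= 4^-1 * S.
  rewrite invfM -mulrA ler_wpM2l// mulrA ler_piMl//.
  by rewrite mulrC ler_pdivrMr// mul1r lerDl.
lra.
Qed.

(** Fatou's lemma, the truncations having uniformly bounded second moments. *)
Lemma cond_exp_L2 : Z \in L2.
Proof.
apply: integral_sqr_L2; first exact: (L1_measurable Z1).
apply: (@le_lt_trans _ _ K%:E); last exact: ltry.
have mz2 n : measurable_fun [set: T] (fun w => (z n w ^+ 2)%:E).
  by apply/measurable_EFinP/measurable_funX/(sub_measurable_fun mG).
have zlim w : (fun n => (z n w ^+ 2)%:E) @ \oo --> (Z w ^+ 2)%:E.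
  apply: cvg_near_cst.
  near=> n; rewrite /z ifT//.
  near: n; exact: nbhs_infty_ger.
have -> : (\int[P]_w (Z w ^+ 2)%:E = \int[P]_w limn_einf (fun n => (z n w ^+ 2)%:E))%E.
  apply: eq_integral => w _; apply/esym.
  by rewrite ((cvg_limn_einf_sup (zlim w)).1).
apply: le_trans (fatou P measurableT mz2 _) _.
  by move=> n w _; rewrite lee_fin sqr_ge0.
rewrite limn_einf_lim; apply: lime_le; first exact: is_cvg_einfs.
apply: nearW => n.
apply: (@le_trans _ _ (\int[P]_w (z n w ^+ 2)%:E)%E).
  by apply: ereal_inf_lbound; exists n => /=.
have := z_bound n; rewrite -lee_fin rmeanE; last exact: L2M.
by rewrite unlock.
Unshelve. all: by end_near. Qed.

End independent_square_integrable.

(** * Independence of the noise from the past *)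

Section noise.
Context {d : measure_display} {T : measurableType d} {R : realType}.
Variable P : probability T R.

(** Dynkin's lemma: the sets independent of C form a lambda-system. *)
Lemma indep_g_sigma (G : set_system T) (C : set T) :
  (forall A, G A -> measurable A) -> setI_closed G -> measurable C ->
  (forall A, G A -> P (A `&` C) = P A * P C)%E ->
  forall A, <<s G >> A -> (P (A `&` C) = P A * P C)%E.
Proof.
move=> mG GI mC GC A GA.
have msG := g_sigma_measurable mG.
have PCfin : P C \is a fin_num by rewrite fin_num_measure.
apply: (@dynkin_induction _ (g_sigma_algebraType G) G
  (fun A : set T => P (A `&` C) = P A * P C)%E) GA => //.
- by rewrite setTI probability_setT mul1e.
- move=> S GS PS; have mS := msG _ GS.
  rewrite probability_setC// muleBl ?fin_num_adde_defr// ?fin_num_measure// mul1e.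
  by rewrite -PS setIC -setDE measureD// ?(setIC C)// ltey_eq PCfin.
- move=> F GF tF PF; have mF k := msG _ (GF k).
  rewrite setI_bigcupl measure_semi_bigcup//.
  + rewrite measure_semi_bigcup//; last exact: bigcup_measurable.
    rewrite -(fineK PCfin) muleC -nneseriesZl//.
    by apply: eq_eseriesr => k _; rewrite [LHS](PF k) fineK// muleC.
  + by move=> k; exact: measurableI.
  + exact: trivIset_setIr.
  + by apply: bigcup_measurable => k _; exact: measurableI.
Qed.

Variables (Gamma n : nat) (s : R) (beta : T -> 'cV[R]_n).
Variable omega : nat -> {RV P >-> R}.
Hypothesis hnoise : white_noise Gamma s beta omega.
Hypothesis hbeta : square_integrable P beta.

Lemma white_noise_L2 t : (t <= Gamma)%N -> (omega t : T -> R) \in Lfun P 2%:E.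
Proof.
move=> tG; apply: integral_sqr_L2 => //.
pose f (r : R) := (r ^+ 2)%:E.
have mf : measurable_fun [set: R] f.
  by apply/measurable_EFinP; exact: measurable_funX.
have f0 r : (0 <= f r)%E by rewrite lee_fin sqr_ge0.
have mW : measurable_fun [set: T] (omega t : T -> measurableTypeR R).
  exact: (measurable_funP (omega t)).
have := hnoise.1 t; rewrite /centered_normal.
case: eqVneq => [s0 H|s0 H].
- rewrite -[X in (X < _)%E](@ge0_integral_distribution _ _ _ _ _ P (omega t) f)//.
  rewrite (eq_measure_integral (\d_(0 : R))); last first.
    by move=> A mA _; exact: (H A tG mA).
  by rewrite integral_dirac// diracT mul1e ltry.
(* The Gaussian law lives on the type R with the sigma-algebra generated by
   half-open intervals, whence the law of omega t is taken there. *)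
- have <- := @ge0_integral_pushforward _ _ _ (measurableTypeR R) R (omega t) mW
    P setT f measurableT mf (fun r _ => f0 r).
  rewrite (eq_measure_integral (normal_prob 0 s)); last first.
    by move=> A mA _; exact: (H A tG mA).
  exact: normal_moment2.
Qed.

Local Notation F i t := (info P beta omega i t).

Lemma rvec_gen_measurable A : rvec_gen beta A -> measurable A.
Proof.
move=> [j _ [B mB <-]].
exact: (L2_measurable (hbeta j)).
Qed.

Lemma info_measurable i t A : F i t A -> measurable A.
Proof.
move=> [[/rvec_gen_measurable//|[k _ [B mB <-]]]|[//]].
exact: measurable_funP.
Qed.

Lemma info_sub i t t' : (t <= t')%N -> F i t `<=` F 0%N t'.
Proof.
move=> tt' A [[?|[k kt ?]]|?]; [by left; left| |by right].
left; right; exists k => //=; rewrite addn0.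
by apply: leq_trans tt'; apply: leq_ltn_trans kt; exact: leq_addr.
Qed.

Let Fam (k : option 'I_Gamma.+1) : set_system T :=
  if k is Some t then <<s rv_gen (omega t) >> else <<s rvec_gen beta >>.

Let Fam_measurable k A : Fam k A -> measurable A.
Proof.
case: k => [k|] /=; apply: g_sigma_measurable; last exact: rvec_gen_measurable.
by move=> B [B' mB' <-]; exact: measurable_funP.
Qed.

Let FamT k : Fam k setT.
Proof.
by case: k => [k|] /=; [exact: (@measurableT _ (g_sigma_algebraType (rv_gen (omega k))))|
  exact: (@measurableT _ (g_sigma_algebraType (rvec_gen beta)))].
Qed.

Let FamI k A B : Fam k A -> Fam k B -> Fam k (A `&` B).
Proof.
by case: k => [k|] /=; [exact: (@measurableI _ (g_sigma_algebraType (rv_gen (omega k))))|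
  exact: (@measurableI _ (g_sigma_algebraType (rvec_gen beta)))].
Qed.

(** The rectangles in beta and the noise before time t.  With the null sets
    they form a pi-system that generates the information at time t. *)
Let past t : set_system T := [set A | exists E : option 'I_Gamma.+1 -> set T,
  [/\ forall k, Fam k (E k), forall k : 'I_Gamma.+1, (t <= k)%N -> E (Some k) = setT
    & A = \bigcap_k E k]].

Let pastI t : setI_closed (past t `|` null_sets P).
Proof.
have pm A : past t A -> measurable A.
  move=> [E [FE _ ->]]; apply: fin_bigcap_measurable; first exact: finite_finset.
  by move=> k _; exact: Fam_measurable (FE k).
have null A N : measurable A -> null_sets P N -> null_sets P (A `&` N).
  move=> mA [mN N0]; split; first exact: measurableI.
  by apply: (subset_measure0 _ _ _ N0) => //; exact: measurableI.
move=> A B [pA|nA] [pB|nB]; last 3 first.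
- by right; apply: null => //; exact: pm.
- by right; rewrite setIC; apply: null => //; exact: pm.
- by right; apply: null => //; case: nA.
left; case: pA pB => [E [FE ET ->]] [E' [FE' ET' ->]].
exists (fun k => E k `&` E' k); split.
- by move=> k; exact: FamI.
- by move=> k tk; rewrite ET// ET'// setTI.
- by rewrite bigcapI.
Qed.

Let info_past t : (t <= Gamma)%N -> F 0%N t `<=` past t `|` null_sets P.
Proof.
move=> tG A [[bA|[k kt kA]]|?]; last by right.
- left; exists (fun k => if k is None then A else setT); split => //.
  + by case=> [k|]; [exact: FamT|exact: sub_sigma_algebra].
  + rewrite eqEsubset; split => [w Aw [k|]//|w /(_ None I)//].
- rewrite /= addn0 in kt.
  have kG : (k < Gamma.+1)%N by rewrite ltnS (leq_trans (ltnW kt)).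
  left; exists (fun j => if j == Some (Ordinal kG) then A else setT); split => //.
  + move=> j; case: eqP => [->|_]; last exact: FamT.
    exact: sub_sigma_algebra.
  + move=> j tj; case: eqP => // -[jk]; move: tj; rewrite jk /=.
    by rewrite leqNgt kt.
  + rewrite eqEsubset; split => [w Aw j _|w /(_ (Some (Ordinal kG)) I)].
      by case: eqP.
    by rewrite eqxx.
Qed.

(** A null set is independent of everything, so the pi-system argument covers
    the augmented sigma-algebra. *)
Lemma info_indep i t : (t <= Gamma)%N ->
  forall A B, <<s F i t >> A -> measurable B ->
  (P (A `&` omega t @^-1` B) = P A * P (omega t @^-1` B))%E.
Proof.
move=> tG A B iA mB.
have mC : measurable (omega t @^-1` B) by exact: measurable_funPTI.
apply: (@indep_g_sigma (past t `|` null_sets P)) => //; last first.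
- apply: sub_sigma_algebra2 iA.
  exact: subset_trans (info_sub (leqnn t)) (info_past tG).
- move=> {iA} A [[E [FE ET ->]]|[mN N0]]; last first.
    rewrite N0 mul0e; apply: (subset_measure0 _ _ _ N0) => //.
    exact: measurableI.
  have tG1 : (t < Gamma.+1)%N by [].
  pose k0 := Some (Ordinal tG1).
  have Ek0 : E k0 = setT by apply: ET.
  pose E' k := if k == k0 then omega t @^-1` B else E k.
  have FE' k : Fam k (E' k).
    rewrite /E'; case: eqP => [->|_//].
    by apply: sub_sigma_algebra; exists B => //; rewrite setTI.
  have setTE : [set` [set: option 'I_Gamma.+1]%SET] = setT.
    by apply/seteqP; split => // x _; rewrite /= inE.
  (* Mutual independence is used for E and for E', which differ only at the
     noise of time t, where E is the whole space. *)
  have h1 := hnoise.2 [set: option 'I_Gamma.+1]%SET E (fun k _ => FE k).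
  have h2 := hnoise.2 [set: option 'I_Gamma.+1]%SET E' (fun k _ => FE' k).
  rewrite setTE in h1 h2.
  have -> : \bigcap_k E k `&` omega t @^-1` B = \bigcap_k E' k.
    rewrite eqEsubset; split => [w [Ew Bw] k _|w E'w].
      by rewrite /E'; case: eqP => // _; exact: Ew.
    split; last by have := E'w k0 I; rewrite /E' eqxx.
    move=> k _; have := E'w k I; rewrite /E'; case: eqP => // -> _.
    by rewrite Ek0.
  rewrite h1 h2 (bigD1 k0) ?inE//= [in RHS](bigD1 k0) ?inE//=.
  rewrite Ek0 probability_setT mul1e.
  have -> : E' k0 = omega t @^-1` B by rewrite /E' eqxx.
  rewrite muleC; congr (_ * _)%E.
  by apply: eq_bigr => k /andP[_ /negPf kk0]; rewrite /E' kk0.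
- move=> A' [[E [FE _ ->]]|[]//]; apply: fin_bigcap_measurable; first exact: finite_finset.
  by move=> k _; exact: Fam_measurable (FE k).
Qed.

End noise.

(** * Random vectors and quadratic forms *)

Section dot_product.
Context {R : realType}.

Definition dot n (u v : 'cV[R]_n) : R := (u^T *m v) ord0 ord0.

Lemma dotE n (u v : 'cV[R]_n) : dot u v = \sum_j u j ord0 * v j ord0.
Proof. by rewrite /dot mxE; apply: eq_bigr => j _; rewrite mxE. Qed.

Lemma dotC n (u v : 'cV[R]_n) : dot u v = dot v u.
Proof. by rewrite !dotE; apply: eq_bigr => j _; rewrite mulrC. Qed.

Lemma dotDl n (u v z : 'cV[R]_n) : dot (u + v) z = dot u z + dot v z.
Proof. by rewrite /dot linearD mulmxDl mxE. Qed.

Lemma dotDr n (u v z : 'cV[R]_n) : dot z (u + v) = dot z u + dot z v.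
Proof. by rewrite /dot mulmxDr mxE. Qed.

Lemma dotZl n a (u v : 'cV[R]_n) : dot (a *: u) v = a * dot u v.
Proof. by rewrite /dot linearZ -scalemxAl mxE. Qed.

Lemma dotZr n a (u v : 'cV[R]_n) : dot u (a *: v) = a * dot u v.
Proof. by rewrite dotC dotZl dotC. Qed.

Lemma dot0l n (u : 'cV[R]_n) : dot 0 u = 0.
Proof. by rewrite -(scale0r 0) dotZl mul0r. Qed.

Lemma dot0r n (u : 'cV[R]_n) : dot u 0 = 0.
Proof. by rewrite dotC dot0l. Qed.

Lemma dot_sumr n I (r : seq I) (F : I -> 'cV[R]_n) u :
  dot u (\sum_(i <- r) F i) = \sum_(i <- r) dot u (F i).
Proof.
elim: r => [|i r IH]; first by rewrite !big_nil dot0r.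
by rewrite !big_cons dotDr IH.
Qed.

Lemma dot_mulmx n p (M : 'M[R]_(n, p)) u v : dot u (M *m v) = dot (M^T *m u) v.
Proof. by rewrite /dot trmx_mul trmxK mulmxA. Qed.

Lemma qform_dot n (M : 'M[R]_n) u : qform M u = dot u (M *m u).
Proof. by rewrite /qform /dot mulmxA. Qed.

End dot_product.

Section random_vectors.
Context {d : measure_display} {T : measurableType d} {R : realType}.
Variable P : probability T R.
Local Notation L1 := (Lfun P 1).
Local Notation L2 := (Lfun P 2%:E).
Local Notation sqi := (square_integrable P).
Local Notation E := (mean P).
Local Notation rmean := (rmean P).

Definition integrable_vec n (X : T -> 'cV[R]_n) : Prop :=
  forall j, coord X j \in L1.
Local Notation ivec := integrable_vec.

Lemma sqi_ivec n (X : T -> 'cV[R]_n) : sqi X -> ivec X.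
Proof. by move=> X2 j; exact: L2_L1. Qed.

Lemma sqiD n (X Y : T -> 'cV[R]_n) : sqi X -> sqi Y -> sqi (fun w => X w + Y w).
Proof.
move=> X2 Y2 j; rewrite (_ : coord _ _ = fun w => coord X j w + coord Y j w).
  exact: L2D.
by apply/funext => w; rewrite /coord mxE.
Qed.

Lemma sqiZ n a (X : T -> 'cV[R]_n) : sqi X -> sqi (fun w => a *: X w).
Proof.
move=> X2 j; rewrite (_ : coord _ _ = fun w => a * coord X j w).
  exact: L2Z.
by apply/funext => w; rewrite /coord mxE.
Qed.

Lemma sqi_cst n (c : 'cV[R]_n) : sqi (fun=> c).
Proof. by move=> j; exact: L2_cst. Qed.

Lemma sqi_sum n I (r : seq I) (F : I -> T -> 'cV[R]_n) :
  (forall i, sqi (F i)) -> sqi (fun w => \sum_(i <- r) F i w).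
Proof.
move=> F2; elim: r => [|i r IH].
  by under eq_fun do rewrite big_nil; exact: sqi_cst.
by under eq_fun do rewrite big_cons; exact: sqiD.
Qed.

Lemma coord_mulmx n p (M : 'M[R]_(n, p)) (X : T -> 'cV[R]_p) j :
  coord (fun w => M *m X w) j = fun w => \sum_k M j k * coord X k w.
Proof. by apply/funext => w; rewrite /coord mxE. Qed.

Lemma sqi_mulmx n p (M : 'M[R]_(n, p)) (X : T -> 'cV[R]_p) :
  sqi X -> sqi (fun w => M *m X w).
Proof.
move=> X2 j; rewrite coord_mulmx.
by apply: L2_sum => k; exact: L2Z.
Qed.

Lemma dot_L1 n (X Y : T -> 'cV[R]_n) :
  (forall j, (fun w => coord X j w * coord Y j w) \in L1) ->
  (fun w => dot (X w) (Y w)) \in L1.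
Proof. by move=> H; under eq_fun do rewrite dotE; exact: L1_sum. Qed.

Lemma sqi_dot n (X Y : T -> 'cV[R]_n) : sqi X -> sqi Y ->
  (fun w => dot (X w) (Y w)) \in L1.
Proof. by move=> X2 Y2; apply: dot_L1 => j; exact: L2M. Qed.

Lemma meanE n (X : T -> 'cV[R]_n) j : E X j ord0 = rmean (coord X j).
Proof. by rewrite mxE. Qed.

Lemma meanD n (X Y : T -> 'cV[R]_n) : ivec X -> ivec Y ->
  E (fun w => X w + Y w) = E X + E Y.
Proof.
move=> X1 Y1; apply/colP => j; rewrite [RHS]mxE !meanE -rmeanD//.
by congr rmean; apply/funext => w; rewrite /coord mxE.
Qed.

Lemma meanZ n a (X : T -> 'cV[R]_n) : ivec X -> E (fun w => a *: X w) = a *: E X.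
Proof.
move=> X1; apply/colP => j; rewrite [RHS]mxE !meanE -rmeanZ//.
by congr rmean; apply/funext => w; rewrite /coord mxE.
Qed.

Lemma mean_cst n (c : 'cV[R]_n) : E (fun=> c) = c.
Proof. by apply/colP => j; rewrite meanE rmean_cst. Qed.

Lemma mean_ae n (X Y : T -> 'cV[R]_n) :
  {ae P, forall w, X w = Y w} -> E X = E Y.
Proof.
move=> XY; apply/colP => j; rewrite !meanE; apply: rmean_ae.
by apply: filterS XY => w; rewrite /coord => ->.
Qed.

Lemma rmean_dot_cst n (c : 'cV[R]_n) (X : T -> 'cV[R]_n) : ivec X ->
  rmean (fun w => dot c (X w)) = dot c (E X).
Proof.
move=> X1; under eq_fun do rewrite dotE.
rewrite (rmean_sum _ (F := fun j w => c j ord0 * coord X j w)); last first.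
  by move=> j; exact: L1Z.
by rewrite dotE; apply: eq_bigr => j _; rewrite rmeanZ// meanE.
Qed.

(** The bilinear form of one mean-field term of the cost,
    E<X, M Y> + <E X, Mb E Y>. *)
Definition mean_form n (M Mb : 'M[R]_n) (X Y : T -> 'cV[R]_n) : R :=
  rmean (fun w => dot (X w) (M *m Y w)) + dot (E X) (Mb *m E Y).

Lemma mean_form_dot n (M Mb : 'M[R]_n) (X Y : T -> 'cV[R]_n) :
  sym M -> sym Mb -> sqi X -> sqi Y ->
  mean_form M Mb X Y = rmean (fun w => dot (M *m X w + Mb *m E X) (Y w)).
Proof.
move=> sM sMb X2 Y2; under [in RHS]eq_fun do rewrite dotDl.
rewrite rmeanD; last 2 first.
- by apply: sqi_dot => //; exact: sqi_mulmx.
- by apply: (sqi_dot (X := fun=> Mb *m E X)) => //; exact: sqi_cst.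
rewrite (rmean_dot_cst _ (sqi_ivec Y2)) /mean_form dot_mulmx sMb; congr (_ + _).
by congr rmean; apply/funext => w; rewrite dot_mulmx sM.
Qed.

Lemma mean_form0 n (M Mb : 'M[R]_n) (X : T -> 'cV[R]_n) :
  mean_form M Mb X (fun=> 0) = 0.
Proof.
rewrite /mean_form mean_cst !mulmx0 dot0r addr0.
by under eq_fun do rewrite dot0r; rewrite rmean_cst.
Qed.

Lemma mean_form_quad n (M Mb : 'M[R]_n) (X Y : T -> 'cV[R]_n) (e : R) :
  sym M -> sym Mb -> sqi X -> sqi Y ->
  mean_form M Mb (fun w => X w + e *: Y w) (fun w => X w + e *: Y w) =
  mean_form M Mb X X + 2 * e * mean_form M Mb X Y + e ^+ 2 * mean_form M Mb Y Y.
Proof.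
move=> sM sMb X2 Y2; rewrite /mean_form.
have MX := sqi_mulmx M X2; have MY := sqi_mulmx M Y2.
have XX := sqi_dot X2 MX; have XY := sqi_dot X2 MY; have YY := sqi_dot Y2 MY.
rewrite meanD; [|exact: sqi_ivec|exact/sqi_ivec/sqiZ].
rewrite meanZ; last exact: sqi_ivec.
have exp (N : 'M[R]_n) u v : sym N -> dot (u + e *: v) (N *m (u + e *: v)) =
    dot u (N *m u) + (2 * e * dot u (N *m v) + e ^+ 2 * dot v (N *m v)).
  move=> sN; rewrite mulmxDr -scalemxAr !dotDl !dotDr !dotZl !dotZr.
  have -> : dot v (N *m u) = dot u (N *m v) by rewrite dot_mulmx sN dotC.
  by ring.
under eq_fun do rewrite exp//.
rewrite !rmeanD ?rmeanZ//; try by do ?[apply: L1D|apply: L1Z].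
rewrite exp//; ring.
Qed.

(** E<X, M X> exceeds <E X, M E X> by the nonnegative E<X - E X, M (X - E X)>,
    so the form is at least the value of M + Mb at E X. *)
Lemma mean_form_ge0 n (M Mb : 'M[R]_n) (X : T -> 'cV[R]_n) :
  psd M -> psd (M + Mb) -> sqi X -> 0 <= mean_form M Mb X X.
Proof.
move=> pM pMb X2; rewrite /mean_form; set c := E X.
have MX := sqi_mulmx M X2.
have : 0 <= rmean (fun w => dot (X w + (-1) *: c) (M *m (X w + (-1) *: c))).
  by apply: rmean_ge0 => w; rewrite -qform_dot.
have exp w : dot (X w + (-1) *: c) (M *m (X w + (-1) *: c)) =
   dot (X w) (M *m X w) + ((-1) * dot (M *m c) (X w) +
     ((-1) * dot (M^T *m c) (X w) + dot c (M *m c))).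
  rewrite mulmxDr -scalemxAr !dotDl !dotDr !dotZl !dotZr.
  by rewrite -(dot_mulmx M) (dotC (M *m c)); ring.
under eq_fun do rewrite exp.
have XX := sqi_dot X2 MX.
have cX N : (fun w => dot (N *m c) (X w)) \in L1.
  by apply: (sqi_dot (X := fun=> N *m c)) => //; exact: sqi_cst.
have cc : (fun _ : T => dot c (M *m c)) \in L1 by exact: L1_cst.
rewrite !rmeanD ?rmeanZ//; try by do ?[apply: L1D|apply: L1Z].
rewrite !(rmean_dot_cst _ (sqi_ivec X2)).
rewrite rmean_cst -/c -(dot_mulmx M) (dotC (M *m c)).
have := pMb c; rewrite qform_dot mulmxDl dotDr; lra.
Qed.

End random_vectors.

(** * Conditional expectation of random vectors *)

Section measurable_vectors.
Context {d : measure_display} {T : measurableType d} {R : realType}.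
Implicit Types G : set_system T.

Lemma measurable_wrt_sub G G' n (X : T -> 'cV[R]_n) :
  G `<=` G' -> measurable_wrt G X -> measurable_wrt G' X.
Proof.
move=> GG' mX j _ B mB; have := mX j measurableT B mB.
exact: (sub_sigma_algebra2 GG').
Qed.

Lemma measurable_wrtD G n (X Y : T -> 'cV[R]_n) :
  measurable_wrt G X -> measurable_wrt G Y ->
  measurable_wrt G (fun w => X w + Y w).
Proof.
move=> mX mY j; rewrite (_ : coord _ _ = fun w => coord X j w + coord Y j w).
  exact: (@measurable_funD _ (g_sigma_algebraType G)).
by apply/funext => w; rewrite /coord mxE.
Qed.

Lemma measurable_wrt_scale G n (f : T -> R) (X : T -> 'cV[R]_n) :
  measurable_fun [set: g_sigma_algebraType G] (f : g_sigma_algebraType G -> R) ->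
  measurable_wrt G X -> measurable_wrt G (fun w => f w *: X w).
Proof.
move=> mf mX j; rewrite (_ : coord _ _ = fun w => f w * coord X j w).
  exact: (@measurable_funM _ (g_sigma_algebraType G)).
by apply/funext => w; rewrite /coord mxE.
Qed.

Lemma measurable_wrt_cst G n (c : 'cV[R]_n) : measurable_wrt G (fun=> c).
Proof. by move=> j; exact: measurable_cst. Qed.

Lemma measurable_wrtZ G n a (X : T -> 'cV[R]_n) :
  measurable_wrt G X -> measurable_wrt G (fun w => a *: X w).
Proof. by apply: measurable_wrt_scale; exact: measurable_cst. Qed.

Lemma measurable_wrt_sum G n I (r : seq I) (F : I -> T -> 'cV[R]_n) :
  (forall i, measurable_wrt G (F i)) ->
  measurable_wrt G (fun w => \sum_(i <- r) F i w).
Proof.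
move=> mF; elim: r => [|i r IH].
  by under eq_fun do rewrite big_nil; exact: measurable_wrt_cst.
by under eq_fun do rewrite big_cons; exact: measurable_wrtD.
Qed.

Lemma measurable_wrt_mulmx G n p (M : 'M[R]_(n, p)) (X : T -> 'cV[R]_p) :
  measurable_wrt G X -> measurable_wrt G (fun w => M *m X w).
Proof.
move=> mX j; rewrite coord_mulmx.
apply: (@measurable_sum _ (g_sigma_algebraType G)) => k.
by apply: (@measurable_funM _ (g_sigma_algebraType G)).
Qed.

End measurable_vectors.

Section conditional_expectation.
Context {d : measure_display} {T : measurableType d} {R : realType}.
Variable P : probability T R.
Local Notation L1 := (Lfun P 1).
Local Notation L2 := (Lfun P 2%:E).
Local Notation sqi := (square_integrable P).
Variable G : set_system T.
Hypothesis mG : forall A, G A -> measurable A.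
Local Notation GT := (g_sigma_algebraType G).

Lemma ex_cond_exp n (X : T -> 'cV[R]_n) : integrable_vec P X ->
  exists Z, cond_exp P G X Z.
Proof.
move=> X1.
have H j := ex_cond_exp_scalar mG (L1_integrable (X1 j)).
pose Z w : 'cV[R]_n := \col_j sval (cid (H j)) w.
have ZE j : coord Z j = sval (cid (H j)).
  by apply/funext => w; rewrite /coord /Z mxE.
exists Z; split=> j; rewrite ?ZE; case: cid => /= z [mz iz zX] //.
by split => //; exact: (L1_integrable (X1 j)).
Qed.

Lemma cond_exp_ae n (X X' Z : T -> 'cV[R]_n) : cond_exp P G X Z ->
  integrable_vec P X' -> {ae P, forall w, X w = X' w} -> cond_exp P G X' Z.
Proof.
move=> [mZ H] X1 XX'; split=> // j; have [iX iZ ZX] := H j; split => //.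
  exact: (L1_integrable (X1 j)).
move=> A GA; rewrite ZX//.
have mA := g_sigma_measurable mG GA.
apply: ae_eq_integral => //.
- exact: measurable_funTS (measurable_int _ iX).
- exact: measurable_funTS (measurable_int _ (L1_integrable (X1 j))).
- by apply: filterS XX' => w; rewrite /coord => ->.
Qed.

Lemma cond_exp_dot n (X Z D : T -> 'cV[R]_n) : cond_exp P G X Z ->
  measurable_wrt G D ->
  (forall j, (fun w => coord X j w * coord D j w) \in L1) ->
  (forall j, (fun w => coord Z j w * coord D j w) \in L1) ->
  rmean P (fun w => dot (X w) (D w)) = rmean P (fun w => dot (Z w) (D w)).
Proof.
move=> XZ mD iX iZ.
have -> : (fun w => dot (X w) (D w)) = fun w => \sum_j coord X j w * coord D j w.
  by apply/funext => w; rewrite dotE.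
have -> : (fun w => dot (Z w) (D w)) = fun w => \sum_j coord Z j w * coord D j w.
  by apply/funext => w; rewrite dotE.
rewrite (rmean_sum _ (F := fun j w => coord X j w * coord D j w))//.
rewrite (rmean_sum _ (F := fun j w => coord Z j w * coord D j w))//.
apply: eq_bigr => j _.
have [_ /(_ j)[X1 Z1 ZX]] := XZ.
apply/eqP; rewrite -subr_eq0 -mulN1r -rmeanZ// -rmeanD//; last exact: L1Z.
rewrite (_ : (fun w => _) = fun w => coord D j w * (coord X j w - coord Z j w)); last first.
  by apply/funext => w; rewrite mulN1r mulrBr ![coord D j w * _]mulrC.
rewrite /rmean unlock (@integral_mul_eq0 _ _ _ P G mG (fun w => coord X j w - coord Z j w))//.
- rewrite (_ : EFin \o _ = (EFin \o coord X j) \- (EFin \o coord Z j))%E//.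
  exact: integrableB.
- move=> A GA; have mA := g_sigma_measurable mG GA.
  under eq_integral do rewrite EFinB.
  rewrite integralB//=; [|exact: (integrableS measurableT)..].
  rewrite ZX// subee// integrable_fin_num//=.
  exact: (integrableS measurableT).
- rewrite (_ : (fun w => _) = (fun w => (coord X j w * coord D j w)%:E) \-
    (fun w => (coord Z j w * coord D j w)%:E))%E.
    by apply: integrableB => //; [exact: (L1_integrable (iX j))|exact: (L1_integrable (iZ j))].
  by apply/funext => w; rewrite /= -EFinB -mulrBl mulrC.
Qed.

Variable W : {RV P >-> R}.
Hypothesis indep : forall A B, <<s G >> A -> measurable B ->
  P (A `&` W @^-1` B) = (P A * P (W @^-1` B))%E.
Hypothesis W2 : (W : T -> R) \in L2.

(** The coefficients of the system at one time are matrices M0 + W M1, with W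
    the noise at that time. *)
Section random_matrix.
Context {p q : nat} (M0 M1 : 'M[R]_(p, q)).
Let M w := M0 + W w *: M1.

(** W is unbounded; what saves square integrability is its independence from
    X. *)
Lemma sqi_rand_mulmx (X : T -> 'cV[R]_q) :
  measurable_wrt G X -> sqi X -> sqi (fun w => M w *m X w).
Proof.
move=> mX X2.
rewrite (_ : (fun w => _) = fun w => M0 *m X w + M1 *m (W w *: X w)); last first.
  by apply/funext => w; rewrite /M mulmxDl -scalemxAl -scalemxAr.
apply: sqiD; first exact: sqi_mulmx.
apply: sqi_mulmx => j.
rewrite (_ : coord _ _ = fun w => W w * coord X j w).
  exact: (L2_mul_indep mG indep W2).
by apply/funext => w; rewrite /coord mxE.
Qed.

Variable theta : T -> 'cV[R]_p.
Hypothesis theta2 : sqi theta.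

Lemma coord_rand_trmx j : coord (fun w => (M w)^T *m theta w) j =
  fun w => coord (fun w => M0^T *m theta w) j w +
           W w * coord (fun w => M1^T *m theta w) j w.
Proof.
apply/funext => w; rewrite /coord /M linearD linearZ /= mulmxDl -scalemxAl.
by rewrite !mxE.
Qed.

Lemma integrable_rand_trmx : integrable_vec P (fun w => (M w)^T *m theta w).
Proof.
move=> j; rewrite coord_rand_trmx; apply: L1D.
  by apply: L2_L1; exact: (sqi_mulmx M0^T theta2 j).
by apply: L2M => //; exact: (sqi_mulmx M1^T theta2 j).
Qed.

(** The vector (M0 + W M1)^T theta is merely integrable, but W can be moved to
    the factor D, which is independent of it. *)
Lemma L1_rand_trmx (D : T -> 'cV[R]_q) j : measurable_wrt G D -> sqi D ->
  (fun w => coord (fun w => (M w)^T *m theta w) j w * coord D j w) \in L1.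
Proof.
move=> mD D2; rewrite coord_rand_trmx.
rewrite (_ : (fun w => _) = fun w =>
  coord (fun w => M0^T *m theta w) j w * coord D j w +
  coord (fun w => M1^T *m theta w) j w * (W w * coord D j w)); last first.
  by apply/funext => w; ring.
apply: L1D; apply: L2M.
- exact: (sqi_mulmx M0^T theta2 j).
- exact: D2.
- exact: (sqi_mulmx M1^T theta2 j).
- exact: (L2_mul_indep mG indep W2 (mD j) (D2 j)).
Qed.

Lemma cond_exp_sqi Z : cond_exp P G (fun w => (M w)^T *m theta w) Z -> sqi Z.
Proof.
move=> H j; have [mZ /(_ j)[X1 Z1 ZX]] := H.
apply: (cond_exp_L2 mG indep W2 (a := coord (fun w => M0^T *m theta w) j)
   (b := coord (fun w => M1^T *m theta w) j)) => //.
- exact: (sqi_mulmx M0^T theta2 j).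
- exact: (sqi_mulmx M1^T theta2 j).
- exact: integrable_L1.
- by move=> A GA; rewrite ZX// coord_rand_trmx.
Qed.

Lemma cond_exp_adjoint Z (D : T -> 'cV[R]_q) :
  cond_exp P G (fun w => (M w)^T *m theta w) Z ->
  measurable_wrt G D -> sqi D ->
  rmean P (fun w => dot (theta w) (M w *m D w)) = rmean P (fun w => dot (Z w) (D w)).
Proof.
move=> H mD D2; rewrite -(cond_exp_dot H mD).
- by congr rmean; apply/funext => w; rewrite dot_mulmx.
- by move=> j; exact: L1_rand_trmx.
- by move=> j; apply: L2M; [exact: (cond_exp_sqi H)|exact: D2].
Qed.

Lemma mean_adjoint (c : 'cV[R]_q) :
  rmean P (fun w => dot (theta w) (M w *m c)) =
  dot (mean P (fun w => (M w)^T *m theta w)) c.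
Proof.
rewrite [RHS]dotC -(rmean_dot_cst _ integrable_rand_trmx).
by congr rmean; apply/funext => w; rewrite dot_mulmx dotC.
Qed.

End random_matrix.

End conditional_expectation.

(** * State and cost *)

Section mean_field_lq.
Context {d : measure_display} {T : measurableType d} {R : realType}.
Variable P : probability T R.
Context {h n : nat} {m : 'I_h.+1 -> nat}.
Variables (L : mflq R n m) (Gamma : nat) (sigma : R).
Variables (beta : T -> 'cV[R]_n) (omega : nat -> {RV P >-> R}).
Hypothesis hweights : weights_ok L.
Hypothesis hnoise : white_noise Gamma sigma beta omega.
Hypothesis hbeta : square_integrable P beta.

Local Notation L1 := (Lfun P 1).
Local Notation L2 := (Lfun P 2%:E).
Local Notation sqi := (square_integrable P).
Local Notation E := (mean P).
Local Notation rmean := (rmean P).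
Local Notation F i t := (info P beta omega i t).
Local Notation controls := (control T R m).
Implicit Types u v dv : controls.

(** An admissible control with its prescribed initial values satisfies this at
    every time; unlike admissibility, it is stable under linear
    combinations. *)
Definition adapted_control v := forall (i : 'I_h.+1) t, (t <= Gamma)%N ->
  measurable_wrt (F i t) (v i t) /\ sqi (v i t).

Let mF i t A : F i t A -> measurable A := @info_measurable _ _ _ P _ beta omega hbeta i t A.

Let adapted_control0 v (i : 'I_h.+1) t : (t <= Gamma)%N -> adapted_control v -> measurable_wrt (F 0%N t) (v i t).
Proof. by move=> tG rv; apply: measurable_wrt_sub (rv i t tG).1; exact: info_sub. Qed.

Let measurable_omega t :
  measurable_fun [set: g_sigma_algebraType (F 0%N t.+1)]
    (omega t : g_sigma_algebraType (F 0%N t.+1) -> R).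
Proof.
move=> _ B mB; apply: sub_sigma_algebra; left; right; exists t => /=.
  by rewrite addn0.
by exists B.
Qed.

Section state.
Variables (b : T -> 'cV[R]_n) (v : controls).
Hypotheses (mb : measurable_wrt (F 0%N 0%N) b) (b2 : sqi b) (rv : adapted_control v).
Local Notation x := (state P L b omega v).

Definition drift t w := cA L *m x t w + cAb L *m E (x t)
     + \sum_i (cB L i *m v i t w + cBb L i *m E (v i t)).
Definition diffusion t w := cC L *m x t w + cCb L *m E (x t)
     + \sum_i (cD L i *m v i t w + cDb L i *m E (v i t)).

Lemma state_adapted t : (t <= Gamma.+1)%N ->
  measurable_wrt (F 0%N t) (x t) /\ sqi (x t).
Proof.
elim: t => [//|t IH] tG; have [mx x2] := IH (ltnW tG).
have v2 i : sqi (v i t) := (rv i tG).2.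
have mv i : measurable_wrt (F 0%N t) (v i t) by exact: adapted_control0.
have FF : F 0%N t `<=` F 0%N t.+1 by exact: info_sub.
have mf : measurable_wrt (F 0%N t) (drift t).
  by do ?[apply: measurable_wrtD|apply: measurable_wrt_mulmx
         |apply: measurable_wrt_cst|apply: measurable_wrt_sum => ?].
have mg : measurable_wrt (F 0%N t) (diffusion t).
  by do ?[apply: measurable_wrtD|apply: measurable_wrt_mulmx
         |apply: measurable_wrt_cst|apply: measurable_wrt_sum => ?].
have f2 : sqi (drift t).
  by do ?[apply: sqiD|apply: sqi_mulmx|apply: sqi_cst|apply: sqi_sum => ?].
have g2 : sqi (diffusion t).
  by do ?[apply: sqiD|apply: sqi_mulmx|apply: sqi_cst|apply: sqi_sum => ?].
split; rewrite (_ : x t.+1 = fun w => drift t w + omega t w *: diffusion t w)//.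
- apply: measurable_wrtD; first exact: measurable_wrt_sub mf.
  apply: measurable_wrt_scale => //; exact: measurable_wrt_sub mg.
- apply: sqiD => //.
  have := sqi_rand_mulmx (@mF 0%N t) (info_indep (i := 0%N) hnoise hbeta tG)
    (white_noise_L2 hnoise tG) 0 1%:M mg g2.
  by under eq_fun do rewrite add0r -scalemxAl mul1mx.
Qed.

End state.

Definition shift_control v (e : R) dv : controls := fun i t w => v i t w + e *: dv i t w.

Local Notation st v := (state P L beta omega v).
Local Notation st0 v := (state P L (fun=> 0) omega v).

Let mbeta : measurable_wrt (F 0%N 0%N) beta.
Proof.
move=> j _ B mB; apply: sub_sigma_algebra; left; left; exists j => //.
by exists B.
Qed.

Let zero_adapted : measurable_wrt (F 0%N 0%N) (fun _ : T => (0 : 'cV[R]_n)) /\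
  sqi (fun _ : T => (0 : 'cV[R]_n)).
Proof. by split; [exact: measurable_wrt_cst|exact: sqi_cst]. Qed.

Lemma state_beta_adapted v t : adapted_control v -> (t <= Gamma.+1)%N ->
  measurable_wrt (F 0%N t) (st v t) /\ sqi (st v t).
Proof. by move=> rv; exact: state_adapted. Qed.

Lemma state0_adapted v t : adapted_control v -> (t <= Gamma.+1)%N ->
  measurable_wrt (F 0%N t) (st0 v t) /\ sqi (st0 v t).
Proof. by move=> rv; apply: state_adapted => //; case: zero_adapted. Qed.

Lemma shift_adapted v e dv : adapted_control v -> adapted_control dv -> adapted_control (shift_control v e dv).
Proof.
move=> rv rd i t tG; have [mv v2] := rv i t tG; have [md d2] := rd i t tG.
split; first by apply: measurable_wrtD => //; exact: measurable_wrtZ.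
by apply: sqiD => //; exact: sqiZ.
Qed.

(** The dynamics is linear, so a perturbation of the control evolves on its
    own, from the origin. *)
Lemma state_shift v e dv t : adapted_control v -> adapted_control dv -> (t <= Gamma.+1)%N ->
  st (shift_control v e dv) t = fun w => st v t w + e *: st0 dv t w.
Proof.
move=> rv rd; elim: t => [_|t IH tG].
  by apply/funext => w /=; rewrite scaler0 addr0.
have {}IH := IH (ltnW tG).
have [_ x2] := state_beta_adapted rv (ltnW tG); have [_ y2] := state0_adapted rd (ltnW tG).
have v2 i : sqi (v i t) := (rv i t tG).2.
have d2 i : sqi (dv i t) := (rd i t tG).2.
have Ex : E (st (shift_control v e dv) t) = E (st v t) + e *: E (st0 dv t).
  by rewrite IH meanD ?meanZ//; do ?[exact: sqi_ivec|exact/sqi_ivec/sqiZ].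
have Ev i : E (shift_control v e dv i t) = E (v i t) + e *: E (dv i t).
  by rewrite /shift_control meanD ?meanZ//; do ?[exact: sqi_ivec|exact/sqi_ivec/sqiZ].
have S (B Bb : forall i, 'M[R]_(n, m i)) w :
    \sum_i (B i *m shift_control v e dv i t w + Bb i *m E (shift_control v e dv i t)) =
    \sum_i (B i *m v i t w + Bb i *m E (v i t)) +
    e *: \sum_i (B i *m dv i t w + Bb i *m E (dv i t)).
  rewrite scaler_sumr -big_split/=; apply: eq_bigr => i _.
  rewrite Ev /shift_control !mulmxDr -!scalemxAr scalerDr.
  by rewrite addrACA.
apply/funext => w /=; rewrite Ex IH !S !mulmxDr -!scalemxAr.
move: (\sum_i _) (\sum_i _) (\sum_i _) (\sum_i _) => s1 s2 s3 s4.
move: (cA L *m _) (cA L *m _) (cAb L *m _) (cAb L *m _)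
  (cC L *m _) (cC L *m _) (cCb L *m _) (cCb L *m _) => a1 a2 a3 a4 a5 a6 a7 a8.
by apply/colP => j; rewrite !mxE; ring.
Qed.

(** The cost as a quadratic form in the state and control processes, and below
    its polar form; separating the state from the control lets the perturbation
    be started from the origin. *)
Definition quad_cost (x : nat -> T -> 'cV[R]_n) v : R :=
  \sum_(t < Gamma.+1) (mean_form P (wQ L) (wQb L) (x t) (x t)
    + \sum_i mean_form P (wR L i) (wRb L i) (v i t) (v i t))
  + mean_form P (wPhi L) (wPhib L) (x Gamma.+1) (x Gamma.+1).

Definition cost_polar (x y : nat -> T -> 'cV[R]_n) v dv : R :=
  \sum_(t < Gamma.+1) (mean_form P (wQ L) (wQb L) (x t) (y t)
    + \sum_i mean_form P (wR L i) (wRb L i) (v i t) (dv i t))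
  + mean_form P (wPhi L) (wPhib L) (x Gamma.+1) (y Gamma.+1).

(** For square-integrable processes the extended-real cost is finite. *)
Lemma cost_quad_cost v : adapted_control v ->
  cost P L Gamma beta omega v = (quad_cost (st v) v)%:E.
Proof.
move=> rv; rewrite /cost /quad_cost EFinD -sumEFin -addeA; congr (_ + _)%E.
- apply: eq_bigr => t _.
  have tG : (t <= Gamma)%N by rewrite -ltnS.
  have [_ x2] := state_beta_adapted rv (ltnW (ltn_ord t)).
  have v2 i : sqi (v i t) := (rv i t tG).2.
  have qx : (fun w => qform (wQ L) (st v t w)) \in L1.
    under eq_fun do rewrite qform_dot; apply: sqi_dot => //; exact: sqi_mulmx.
  have qv i : (fun w => qform (wR L i) (v i t w)) \in L1.
    under eq_fun do rewrite qform_dot; apply: sqi_dot => //; exact: sqi_mulmx.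
  rewrite -rmeanE; last first.
    by do ?[apply: L1D|apply: L1_sum => ?|exact: L1_cst|exact: qx|exact: qv].
  congr (_%:E); rewrite rmeanD; last first.
  + by do ?[apply: L1D|apply: L1_sum => ?|exact: L1_cst|exact: qv].
  + by do ?[apply: L1D|exact: L1_cst].
  congr (_ + _).
    rewrite rmeanD//; last exact: L1_cst.
    by rewrite rmean_cst /mean_form qform_dot; under eq_fun do rewrite qform_dot.
  rewrite (rmean_sum _ (F := fun i w => qform (wR L i) (v i t w) +
     qform (wRb L i) (E (v i t)))); last by move=> i; apply: L1D => //; exact: L1_cst.
  apply: eq_bigr => i _; rewrite rmeanD//; last exact: L1_cst.
  by rewrite rmean_cst /mean_form qform_dot; under eq_fun do rewrite qform_dot.
- have [_ x2] := state_beta_adapted rv (leqnn Gamma.+1).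
  rewrite -rmeanE; last first.
    under eq_fun do rewrite qform_dot; apply: sqi_dot => //; exact: sqi_mulmx.
  by rewrite -EFinD /mean_form qform_dot; under eq_fun do rewrite qform_dot.
Qed.

Let sum_quad I (r : seq I) (f g k : I -> R) e :
  \sum_(i <- r) (f i + (2 * e * g i + e ^+ 2 * k i)) =
  \sum_(i <- r) f i + (2 * e * \sum_(i <- r) g i + e ^+ 2 * \sum_(i <- r) k i).
Proof. by rewrite !big_split/= -!mulr_sumr. Qed.

Lemma quad_cost_shift v e dv : adapted_control v -> adapted_control dv ->
  quad_cost (st (shift_control v e dv)) (shift_control v e dv) =
  quad_cost (st v) v + 2 * e * cost_polar (st v) (st0 dv) v dv + e ^+ 2 * quad_cost (st0 dv) dv.
Proof.
move=> rv rd.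
have [[sQ sQb sPhi sPhib] sR _ _ _] := hweights.
rewrite /quad_cost /cost_polar state_shift// mean_form_quad//; last 2 first.
- by have [] := state_beta_adapted rv (leqnn Gamma.+1).
- by have [] := state0_adapted rd (leqnn Gamma.+1).
rewrite (eq_bigr (fun t : 'I_Gamma.+1 =>
  (mean_form P (wQ L) (wQb L) (st v t) (st v t) +
     \sum_i mean_form P (wR L i) (wRb L i) (v i t) (v i t)) +
  (2 * e * (mean_form P (wQ L) (wQb L) (st v t) (st0 dv t) +
     \sum_i mean_form P (wR L i) (wRb L i) (v i t) (dv i t)) +
   e ^+ 2 * (mean_form P (wQ L) (wQb L) (st0 dv t) (st0 dv t) +
     \sum_i mean_form P (wR L i) (wRb L i) (dv i t) (dv i t))))); last first.
  move=> t _; have tG : (t <= Gamma)%N by rewrite -ltnS.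
  rewrite state_shift// ?(ltnW (ltn_ord t))// mean_form_quad//; last 2 first.
  - by have [] := state_beta_adapted rv (ltnW (ltn_ord t)).
  - by have [] := state0_adapted rd (ltnW (ltn_ord t)).
  rewrite (eq_bigr (fun i => mean_form P (wR L i) (wRb L i) (v i t) (v i t) +
    (2 * e * mean_form P (wR L i) (wRb L i) (v i t) (dv i t) +
     e ^+ 2 * mean_form P (wR L i) (wRb L i) (dv i t) (dv i t)))); last first.
    move=> i _; rewrite /shift_control mean_form_quad ?addrA//; by [
      case: (sR i)|case: (rv i t tG)|case: (rd i t tG)].
  rewrite sum_quad; ring.
rewrite sum_quad; ring.
Qed.

(** Convexity of the cost. *)
Lemma quad_cost0_ge0 dv : adapted_control dv -> 0 <= quad_cost (st0 dv) dv.
Proof.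
move=> rd; have [_ _ [pQ pQb] pR [pPhi pPhib]] := hweights.
have pdW k (M : 'M[R]_k) : pd M -> psd M.
  move=> pM u; have [->|u0] := eqVneq u 0; last exact/ltW/pM.
  by rewrite qform_dot dot0l.
apply: addr_ge0; last first.
  by apply: mean_form_ge0 => //; have [] := state0_adapted rd (leqnn Gamma.+1).
apply: sumr_ge0 => t _; apply: addr_ge0.
  by apply: mean_form_ge0 => //; have [] := state0_adapted rd (ltnW (ltn_ord t)).
apply: sumr_ge0 => i _; have [pRi pRbi] := pR i.
apply: mean_form_ge0; [exact: pdW|exact: pdW|].
by case: (rd i t (ltn_ord t)).
Qed.


Local Notation A t w := (At L omega t w).
Local Notation Ab t w := (Abt L omega t w).
Local Notation B i t w := (Bt L omega i t w).
Local Notation Bb i t w := (Bbt L omega i t w).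

Let indep t (tG : (t <= Gamma)%N) i : forall C D, <<s F i t >> C ->
  measurable D -> (P (C `&` omega t @^-1` D) = P C * P (omega t @^-1` D))%E.
Proof. exact: (info_indep hnoise hbeta tG). Qed.

Let omega2 t (tG : (t <= Gamma)%N) : (omega t : T -> R) \in L2.
Proof. exact: (white_noise_L2 hnoise). Qed.

Let sqi_noisy t i p q (M0 M1 : 'M[R]_(p, q)) (X : T -> 'cV[R]_q) :
  (t <= Gamma)%N -> measurable_wrt (F i t) X -> sqi X ->
  sqi (fun w => (M0 + omega t w *: M1) *m X w).
Proof.
by move=> tG; exact: (sqi_rand_mulmx (@mF i t) (@indep t tG i) (omega2 tG) M0 M1).
Qed.

Let sqi_noisy_cst t p q (M0 M1 : 'M[R]_(p, q)) (c : 'cV[R]_q) :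
  (t <= Gamma)%N -> sqi (fun w => (M0 + omega t w *: M1) *m c).
Proof.
move=> tG; apply: (@sqi_noisy t 0%N p q M0 M1 (fun=> c)) => //.
  exact: measurable_wrt_cst.
exact: sqi_cst.
Qed.

(** * Costate and first variation *)

(** The costate equations in weak form, as pairings with the variables known
    at each time: the form in which they are used by summation by parts, and
    which modifications on null sets preserve. *)
Definition adjoint_process (x : nat -> T -> 'cV[R]_n)
    (theta : nat -> T -> 'cV[R]_n) : Prop :=
  [/\ forall t, (t <= Gamma)%N -> sqi (theta t),
      forall y, sqi y -> rmean (fun w => dot (theta Gamma w) (y w)) =
        mean_form P (wPhi L) (wPhib L) (x Gamma.+1) y
    & forall t y, (1 <= t <= Gamma)%N -> measurable_wrt (F 0%N t) y -> sqi y ->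
        rmean (fun w => dot (theta t.-1 w) (y w)) =
        mean_form P (wQ L) (wQb L) (x t) y +
        rmean (fun w => dot (theta t w) (A t w *m y w + Ab t w *m E y))].

Lemma costate_adjoint v theta theta' : adapted_control v ->
  (forall t, (t <= Gamma)%N -> sqi (theta' t)) ->
  (forall t, (t <= Gamma)%N -> {ae P, forall w, theta t w = theta' t w}) ->
  costate P L Gamma beta omega v theta -> adjoint_process (st v) theta'.
Proof.
move=> rv th2 thE [thG thS].
have [[sQ sQb sPhi sPhib] _ _ _ _] := hweights.
split=> //.
- move=> y y2; have [_ x2] := state_beta_adapted rv (leqnn Gamma.+1).
  rewrite mean_form_dot//; apply: rmean_ae.
  by apply: filterS (thE _ (leqnn Gamma)) => w <-; rewrite thG.
- move=> t y tG my y2; have [t0 tG'] := andP tG.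
  have [Z [cZ thZ]] := thS t tG.
  have [_ x2] := state_beta_adapted rv (ltnW (tG' : (t < Gamma.+1)%N)).
  have cZ' : cond_exp P (F 0%N t) (fun w => (A t w)^T *m theta' t w) Z.
    apply: (cond_exp_ae (@mF 0%N t) cZ).
      exact: (integrable_rand_trmx (omega2 tG') (cA L) (cC L) (th2 _ tG')).
    by apply: filterS (thE _ tG') => w ->.
  have Z2 : sqi Z.
    exact: (cond_exp_sqi (@mF 0%N t) (@indep t tG' 0%N) (omega2 tG') (th2 _ tG') cZ').
  have cE : E (fun w => (Ab t w)^T *m theta t w) = E (fun w => (Ab t w)^T *m theta' t w).
    by apply: mean_ae; apply: filterS (thE _ tG') => w ->.
  pose c := E (fun w => (Ab t w)^T *m theta' t w).
  rewrite cE -/c in thZ.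
  have -> : rmean (fun w => dot (theta' t.-1 w) (y w)) =
    rmean (fun w => dot (wQ L *m st v t w + wQb L *m E (st v t)) (y w) +
      (dot (Z w) (y w) + dot c (y w))).
    apply: rmean_ae; have tG1 := leq_trans (leq_pred t) tG'.
    by apply: filterS2 (thE _ tG1) thZ => w <- ->; rewrite !dotDl !addrA.
  have QL : (fun w => dot (wQ L *m st v t w + wQb L *m E (st v t)) (y w)) \in L1.
    apply: (sqi_dot (X := fun w => wQ L *m st v t w + wQb L *m E (st v t))) => //.
    by apply: sqiD; [exact: sqi_mulmx|exact: sqi_cst].
  have ZL := sqi_dot Z2 y2.
  have cL : (fun w => dot c (y w)) \in L1.
    by apply: (sqi_dot (X := fun=> c)) => //; exact: sqi_cst.
  rewrite rmeanD//; last exact: L1D.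
  rewrite rmeanD// mean_form_dot//; congr (_ + _).
  rewrite (rmean_dot_cst _ (sqi_ivec y2)).
  rewrite -(cond_exp_adjoint (@mF 0%N t) (@indep t tG' 0%N) (omega2 tG') (th2 _ tG') cZ' my y2).
  rewrite -(mean_adjoint (omega2 tG') (cAb L) (cCb L) (th2 _ tG')) -rmeanD.
  + by congr rmean; apply/funext => w; rewrite dotDr.
  + by apply: sqi_dot; [exact: th2|exact: sqi_noisy my y2].
  + by apply: sqi_dot; [exact: th2|exact: sqi_noisy_cst].
Qed.

(** Contribution of the i-th control at time t to the first variation. *)
Definition gradient (theta : nat -> T -> 'cV[R]_n) v dv i t : R :=
  mean_form P (wR L i) (wRb L i) (v i t) (dv i t) +
  rmean (fun w => dot (theta t w) (B i t w *m dv i t w + Bb i t w *m E (dv i t))).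

(** Summation by parts: E<theta(k), y(k+1)> telescopes by the weak costate
    equations, starting from y(0) = 0 and ending with the terminal weight. *)
Lemma cost_polar_gradient v dv theta : adapted_control v -> adapted_control dv ->
  adjoint_process (st v) theta ->
  cost_polar (st v) (st0 dv) v dv =
  \sum_(t < Gamma.+1) \sum_i gradient theta v dv i t.
Proof.
move=> rv rd [th2 thG thS].
pose y := st0 dv.
pose b i t := rmean (fun w => dot (theta t w)
  (B i t w *m dv i t w + Bb i t w *m E (dv i t))).
have b1 i t : (t <= Gamma)%N ->
    sqi (fun w => B i t w *m dv i t w + Bb i t w *m E (dv i t)).
  move=> tG; have [md d2] := rd i t tG.
  by apply: sqiD; [exact: sqi_noisy md d2|exact: sqi_noisy_cst].
have step t : (t <= Gamma)%N -> rmean (fun w => dot (theta t w) (y t.+1 w)) =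
    rmean (fun w => dot (theta t w) (A t w *m y t w + Ab t w *m E (y t))) +
    \sum_i b i t.
  move=> tG; have [my y2] := state0_adapted rd (leq_trans tG (leqnSn _)).
  rewrite /b -(rmean_sum _ (F := fun i w => dot (theta t w)
    (B i t w *m dv i t w + Bb i t w *m E (dv i t)))); last first.
    by move=> i; apply: sqi_dot; [exact: th2|exact: b1].
  rewrite -rmeanD; last 2 first.
  - apply: sqi_dot; first exact: th2.
    by apply: sqiD; [exact: sqi_noisy my y2|exact: sqi_noisy_cst].
  - by apply: L1_sum => i; apply: sqi_dot; [exact: th2|exact: b1].
  congr rmean; apply/funext => w; rewrite -dot_sumr -dotDr; congr dot.
  rewrite /y /= /At /Abt /Bt /Bbt.
  rewrite [in RHS](eq_bigr (fun i => (cB L i *m dv i t w + cBb L i *m E (dv i t)) +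
    omega t w *: (cD L i *m dv i t w + cDb L i *m E (dv i t)))); last first.
    by move=> i _; rewrite !mulmxDl -!scalemxAl scalerDr addrACA.
  rewrite [in RHS]big_split/= -scaler_sumr !mulmxDl -!scalemxAl.
  move: (\sum_i _) (\sum_i _) => s1 s2.
  move: (cA L *m _) (cAb L *m _) (cC L *m _) (cCb L *m _) => a1 a2 a3 a4.
  by apply/colP => j; rewrite !mxE; ring.
have tele k : (k <= Gamma)%N -> rmean (fun w => dot (theta k w) (y k.+1 w)) =
    \sum_(t < k.+1) (\sum_i b i t - mean_form P (wQ L) (wQb L) (st v t) (y t)).
  elim: k => [_|k IH kG].
    rewrite step// big_ord1 [X in _ - X]mean_form0 subr0.
    rewrite (_ : (fun w => _) = fun=> 0) ?rmean_cst ?add0r//.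
    by apply/funext => w; rewrite /y /= mean_cst !mulmx0 addr0 dot0r.
  have [my y2] := state0_adapted rd (leq_trans kG (leqnSn _)).
  rewrite step// [RHS]big_ord_recr/= -IH ?(ltnW kG)//.
  have := thS k.+1 (y k.+1) kG my y2; rewrite /= -/y => ->.
  by ring.
rewrite /cost_polar -thG; last by have [] := state0_adapted rd (leqnn Gamma.+1).
rewrite tele// -big_split/=; apply: eq_bigr => t _.
have -> : \sum_i gradient theta v dv i t =
  \sum_i mean_form P (wR L i) (wRb L i) (v i t) (dv i t) + \sum_i b i t.
  by rewrite -big_split.
by rewrite -/y; ring.
Qed.


Lemma gradient0 theta v dv i t : dv i t = (fun=> 0) -> gradient theta v dv i t = 0.
Proof.
move=> dv0; rewrite /gradient dv0 mean_form0 add0r mean_cst.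
rewrite (_ : (fun w => _) = fun=> 0) ?rmean_cst//.
by apply/funext => w; rewrite !mulmx0 addr0 dot0r.
Qed.

(** The part of the equilibrium condition outside the conditional
    expectation. *)
Definition explicit_gradient (theta : nat -> T -> 'cV[R]_n) v i t w :=
  wR L i *m v i t w + wRb L i *m E (v i t) + E (fun w' => (Bb i t w')^T *m theta t w').

Lemma gradientE theta v dv (i : 'I_h.+1) t : adapted_control v -> (t <= Gamma)%N ->
  sqi (theta t) -> measurable_wrt (F i t) (dv i t) -> sqi (dv i t) ->
  gradient theta v dv i t =
  rmean (fun w => dot (explicit_gradient theta v i t w) (dv i t w)) +
  rmean (fun w => dot ((B i t w)^T *m theta t w) (dv i t w)).
Proof.
move=> rv tG th2 md d2.
have [_ sR _ _ _] := hweights; have [sRi sRbi] := sR i.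
have [mv v2] := rv i t tG.
rewrite /gradient mean_form_dot//.
have s1 : sqi (fun w => wR L i *m v i t w + wRb L i *m E (v i t)).
  by apply: sqiD; [exact: sqi_mulmx|exact: sqi_cst].
have s2 : sqi (fun w => B i t w *m dv i t w) by exact: sqi_noisy md d2.
have s3 : sqi (fun w => Bb i t w *m E (dv i t)) by exact: sqi_noisy_cst.
under [X in _ + rmean X = _]eq_fun do rewrite dotDr.
rewrite rmeanD; [|exact: sqi_dot|exact: sqi_dot].
rewrite (mean_adjoint (omega2 tG) (cBb L i) (cDb L i) th2).
rewrite -(rmean_dot_cst _ (sqi_ivec d2)) /explicit_gradient.
under [X in _ = rmean X + _]eq_fun do rewrite dotDl.
rewrite [in RHS]rmeanD; last 2 first.
- exact: sqi_dot s1 d2.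
- by apply: (sqi_dot (X := fun=> E _)) => //; exact: sqi_cst.
under [X in _ = _ + rmean X]eq_fun do rewrite -dot_mulmx.
by rewrite /Bbt addrA addrAC.
Qed.

Lemma equilibrium_gradient theta v dv (i : 'I_h.+1) t : adapted_control v -> (i <= t <= Gamma)%N ->
  sqi (theta t) -> measurable_wrt (F i t) (dv i t) -> sqi (dv i t) ->
  (exists Z, cond_exp P (F i t) (fun w => (B i t w)^T *m theta t w) Z /\
      {ae P, forall w, 0 =
         wR L i *m v i t w + wRb L i *m E (v i t) + Z w
         + E (fun w' => (Bb i t w')^T *m theta t w')}) ->
  gradient theta v dv i t = 0.
Proof.
move=> rv /andP[it tG] th2 md d2 [Z [cZ eqZ]].
rewrite gradientE//.
have Z2 := cond_exp_sqi (@mF i t) (@indep t tG i) (omega2 tG) th2 cZ.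
rewrite (cond_exp_dot (@mF i t) cZ md); last 2 first.
- by move=> j; apply: (L1_rand_trmx (@mF i t) (@indep t tG i) (omega2 tG)).
- by move=> j; apply: L2M; [exact: Z2|exact: d2].
have [mv v2] := rv i t tG.
rewrite -rmeanD; last 2 first.
- apply: sqi_dot d2; apply: sqiD; last exact: sqi_cst.
  by apply: sqiD; [exact: sqi_mulmx|exact: sqi_cst].
- exact: sqi_dot.
rewrite -(rmean_cst P 0); apply: rmean_ae; apply: filterS eqZ => w Zw.
by rewrite -dotDl /explicit_gradient addrAC -Zw dot0l.
Qed.


(** * Existence and regularity of costates *)

(** Backward iteration, with a conditional expectation chosen at each step. *)
Definition backward_step v t (X : T -> 'cV[R]_n) : T -> 'cV[R]_n := fun w =>
  wQ L *m st v t w + wQb L *m E (st v t)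
  + xget (fun=> 0) [set Z | cond_exp P (F 0%N t) (fun w => (A t w)^T *m X w) Z] w
  + E (fun w' => (Ab t w')^T *m X w').

(** Indexed by the time to go: stage k is the costate at time Gamma - k. *)
Fixpoint backward v k : T -> 'cV[R]_n :=
  if k is k'.+1 then backward_step v (Gamma - k') (backward v k')
  else fun w => wPhi L *m st v Gamma.+1 w + wPhib L *m E (st v Gamma.+1).

Let cond_exp_xget t (X : T -> 'cV[R]_n) : (t <= Gamma)%N -> sqi X ->
  cond_exp P (F 0%N t) (fun w => (A t w)^T *m X w)
    (xget (fun=> 0) [set Z | cond_exp P (F 0%N t) (fun w => (A t w)^T *m X w) Z]).
Proof.
move=> tG X2.
have i1 := integrable_rand_trmx (omega2 tG) (cA L) (cC L) X2.
have [Z cZ] := ex_cond_exp (@mF 0%N t) i1.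
by have := xgetPex (fun=> 0) (ex_intro _ Z cZ : exists Z, [set Z | _] Z).
Qed.

Lemma sqi_backward v k : adapted_control v -> (k <= Gamma)%N -> sqi (backward v k).
Proof.
move=> rv; elim: k => [_|k IH kG] /=.
  have [_ x2] := state_beta_adapted rv (leqnn Gamma.+1).
  by apply: sqiD; [exact: sqi_mulmx|exact: sqi_cst].
have {}IH := IH (ltnW kG).
have tG : (Gamma - k <= Gamma)%N by exact: leq_subr.
have [_ x2] := state_beta_adapted rv (leq_trans tG (leqnSn _)).
apply: sqiD; last exact: sqi_cst.
apply: sqiD; first by apply: sqiD; [exact: sqi_mulmx|exact: sqi_cst].
exact: (cond_exp_sqi (@mF _ _) (@indep _ tG 0%N) (omega2 tG) IH (cond_exp_xget tG IH)).
Qed.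

Lemma ex_costate v : adapted_control v -> exists theta, costate P L Gamma beta omega v theta /\
  (forall t, (t <= Gamma)%N -> sqi (theta t)).
Proof.
move=> rv; exists (fun t => backward v (Gamma - t)); split; last first.
  by move=> t tG; apply: sqi_backward => //; exact: leq_subr.
split; first by move=> w; rewrite subnn.
move=> t /andP[t0 tG].
have th2 : sqi (backward v (Gamma - t)).
  by apply: sqi_backward => //; exact: leq_subr.
exists (xget (fun=> 0) [set Z | cond_exp P (F 0%N t)
  (fun w => (A t w)^T *m backward v (Gamma - t) w) Z]).
split; first exact: cond_exp_xget.
apply: aeW => w.
have -> : (Gamma - t.-1 = (Gamma - t).+1)%N by lia.
by rewrite /= subKn.
Qed.

(** Each step of the backward iteration equates theta(t-1), almost surely,
    with an expression that is measurable and square integrable as soon as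
    theta(t) has such a modification. *)
Lemma costate_modification v theta : adapted_control v ->
  costate P L Gamma beta omega v theta ->
  exists theta', (forall t, (t <= Gamma)%N -> sqi (theta' t)) /\
    (forall t, (t <= Gamma)%N -> {ae P, forall w, theta t w = theta' t w}).
Proof.
move=> rv [thG thS].
have H k : (k <= Gamma)%N -> exists X, sqi X /\
    {ae P, forall w, theta (Gamma - k)%N w = X w}.
  elim: k => [_|k IH kG].
    rewrite subn0; have [_ x2] := state_beta_adapted rv (leqnn Gamma.+1).
    exists (fun w => wPhi L *m st v Gamma.+1 w + wPhib L *m E (st v Gamma.+1)).
    split; last by apply: aeW => w; rewrite thG.
    by apply: sqiD; [exact: sqi_mulmx|exact: sqi_cst].
  have [X [X2 thX]] := IH (ltnW kG).
  set t := (Gamma - k)%N in thX.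
  have tG : (t <= Gamma)%N by exact: leq_subr.
  have t0 : (0 < t)%N by rewrite subn_gt0.
  have [|Z [cZ thZ]] := thS t; first by rewrite t0.
  have cZ' : cond_exp P (F 0%N t) (fun w => (A t w)^T *m X w) Z.
    apply: (cond_exp_ae (@mF 0%N t) cZ).
      exact: (integrable_rand_trmx (omega2 tG) (cA L) (cC L) X2).
    by apply: filterS thX => w ->.
  have Z2 := cond_exp_sqi (@mF 0%N t) (@indep t tG 0%N) (omega2 tG) X2 cZ'.
  exists (fun w => wQ L *m st v t w + wQb L *m E (st v t) + Z w
          + E (fun w' => (Ab t w')^T *m theta t w')).
  split.
    have [_ x2] := state_beta_adapted rv (leq_trans tG (leqnSn _)).
    apply: sqiD; last exact: sqi_cst.
    by apply: sqiD => //; apply: sqiD; [exact: sqi_mulmx|exact: sqi_cst].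
  by rewrite subnS.
have /choice[X HX] : forall t, exists X : T -> 'cV[R]_n, (t <= Gamma)%N ->
    sqi X /\ {ae P, forall w, theta t w = X w}.
  move=> t; have [tG|tG] := leqP t Gamma; last by exists (fun=> 0).
  have [X HX] := H _ (leq_subr t Gamma).
  by exists X => _; move: HX; rewrite subKn.
by exists X; split => t tG; case: (HX t tG).
Qed.

Lemma equilibrium_modification v theta theta' :
  (forall t, (t <= Gamma)%N -> sqi (theta' t)) ->
  (forall t, (t <= Gamma)%N -> {ae P, forall w, theta t w = theta' t w}) ->
  equilibrium P L Gamma beta omega v theta ->
  equilibrium P L Gamma beta omega v theta'.
Proof.
move=> th2 thE eq i t itG; have [_ tG] := andP itG.
have [Z [cZ eqZ]] := eq i t itG; exists Z; split.
  apply: (cond_exp_ae (@mF i t) cZ).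
    exact: (integrable_rand_trmx (omega2 tG) (cB L i) (cD L i) (th2 t tG)).
  by apply: filterS (thE t tG) => w ->.
rewrite (_ : E (fun w' => (Bb i t w')^T *m theta' t w') =
  E (fun w' => (Bb i t w')^T *m theta t w'))//.
by apply: mean_ae; apply: filterS (thE t tG) => w ->.
Qed.

Variable v0 : controls.
Hypothesis hv0 : initial_control P beta omega v0.

Lemma admissible_adapted v : admissible P Gamma beta omega v0 v -> adapted_control v.
Proof.
move=> [vE vad] i t tG; have [it|ti] := leqP i t; first by apply: vad; rewrite it.
by rewrite vE//; exact: hv0.
Qed.

(** * Optimality and equilibrium *)

(** The difference of two admissible controls vanishes at the prescribed times
    and is a direction in which the first variation is zero, so the cost
    exceeds that of v by the cost of the difference. *)
Lemma equilibrium_optimal v : solves_equilibrium P L Gamma beta omega v0 v ->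
  solves_problem P L Gamma beta omega v0 v.
Proof.
move=> [av [theta [cth eqth]]]; have rv := admissible_adapted av.
split=> // u au; have ru := admissible_adapted au.
have [theta' [th2 thE]] := costate_modification rv cth.
have adj := costate_adjoint rv th2 thE cth.
have eq' := equilibrium_modification th2 thE eqth.
pose dv : controls := fun i t w => u i t w + (-1) *: v i t w.
have rd : adapted_control dv := shift_adapted (-1) ru rv.
have uE : u = shift_control v 1 dv.
  apply: functional_extensionality_dep => i; apply/funext => t; apply/funext => w.
  by rewrite /shift_control /dv scale1r scaleN1r addrCA subrr addr0.
rewrite !cost_quad_cost// lee_fin uE quad_cost_shift// (cost_polar_gradient rv rd adj).
rewrite big1 ?mulr0 ?addr0 => [|t _].
  by rewrite expr1n mul1r lerDl; exact: quad_cost0_ge0.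
have tG : (t <= Gamma)%N by rewrite -ltnS.
apply: big1 => i _; have [it|ti] := leqP i t.
  have [md d2] := rd i t tG.
  by apply: equilibrium_gradient => //; [rewrite it|exact: th2|apply: eq'; rewrite it].
apply: gradient0; apply/funext => w.
by rewrite /dv (proj1 au)// (proj1 av)// scaleN1r subrr.
Qed.

(** A polynomial 2 e D + e^2 q that is nonnegative for all e has D = 0. *)
Lemma optimal_gradient v theta dv : solves_problem P L Gamma beta omega v0 v ->
  adjoint_process (st v) theta -> adapted_control dv ->
  (forall (i : 'I_h.+1) t, (t < i)%N -> dv i t = fun=> 0) ->
  \sum_(t < Gamma.+1) \sum_i gradient theta v dv i t = 0.
Proof.
move=> [av opt] adj rd dv0; have rv := admissible_adapted av.
rewrite -(cost_polar_gradient rv rd adj); set D := cost_polar _ _ _ _.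
set q := quad_cost (st0 dv) dv.
have q0 : 0 <= q by exact: quad_cost0_ge0.
have H e : 0 <= 2 * e * D + e ^+ 2 * q.
  have rs := shift_adapted e rv rd.
  have ad : admissible P Gamma beta omega v0 (shift_control v e dv).
    split=> [i t ti|i t /andP[_ tG]]; last exact: rs.
    by apply/funext => w; rewrite /shift_control dv0// scaler0 addr0 (proj1 av).
  have := opt _ ad; rewrite !cost_quad_cost// lee_fin quad_cost_shift// -addrA.
  by rewrite lerDl.
(* The minimizer - D / q, with q + 1 instead of q since q may vanish. *)
have := H (- D / (q + 1)).
have -> : 2 * (- D / (q + 1)) * D + (- D / (q + 1)) ^+ 2 * q =
   - (D ^+ 2 * ((q + 2) / (q + 1) ^+ 2)).
  by field; rewrite gt_eqF// ltr_wpDl.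
rewrite oppr_ge0 => H1.
have c0 : 0 < (q + 2) / (q + 1) ^+ 2.
  by rewrite divr_gt0 ?exprn_gt0// ltr_wpDl.
move: H1; rewrite pmulr_lle0// => H1.
by apply/eqP; rewrite -sqrf_eq0 eq_le H1 sqr_ge0.
Qed.

(** The direction that is the j-th basis vector on S, for the control i0 at time
    t0 only.  Coordinates are compared as natural numbers because the dimension
    of a control depends on its index. *)
Definition probe (i0 : 'I_h.+1) t0 (S : set T) (j : nat) : controls :=
  fun i t w => \col_k ((i == i0) && (t == t0) && (k == j :> nat) && (w \in S))%:R.

Lemma probe_adapted (i0 : 'I_h.+1) t0 S j : <<s F i0 t0 >> S -> adapted_control (probe i0 t0 S j).
Proof.
move=> FS i t tG.
have mS : measurable S := g_sigma_measurable (@mF i0 t0) FS.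
have coordE k : coord (probe i0 t0 S j i t) k =
    if (i == i0) && (t == t0) && (k == j :> nat) then \1_S else fun=> 0.
  apply/funext => w; rewrite /coord /probe mxE.
  by case: (_ && (k == j :> nat)); rewrite //= indicE.
split=> k; rewrite coordE.
- case: ifP => [/andP[/andP[/eqP ii0 /eqP tt0] _]|_]; last exact: measurable_cst.
  apply: (@measurable_indic _ (g_sigma_algebraType (F i t))).
  by rewrite ii0 tt0.
- case: ifP => _; last exact: L2_cst.
  apply: integral_sqr_L2; first exact: measurable_indic.
  apply: (@le_lt_trans _ _ (P S)); last by rewrite ltey_eq fin_num_measure.
  rewrite -(setIT S) -integral_indic//= setIT.
  rewrite le_eqVlt; apply/orP; left; apply/eqP; apply: eq_integral => w _.
  by rewrite indicE; case: (w \in S); rewrite ?expr1n ?expr0n.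
Qed.

(** No conditional expectation has to be constructed here: the equilibrium
    condition dictates that it be minus the rest of the equation, and the
    stationarity of the cost along the probes says that this candidate has the
    right integrals. *)
Lemma optimal_equilibrium v : solves_problem P L Gamma beta omega v0 v ->
  solves_equilibrium P L Gamma beta omega v0 v.
Proof.
move=> sv; have [av _] := sv; have rv := admissible_adapted av.
split=> //.
have [theta [cth th2]] := ex_costate rv; exists theta; split => // i t itG.
have adj := costate_adjoint rv th2 (fun t _ => aeW _ (fun w => erefl)) cth.
have [it tG] := andP itG; have [mv v2] := rv i t tG.
pose Z w := - explicit_gradient theta v i t w.
have mZ : measurable_wrt (F i t) Z.
  rewrite /Z /explicit_gradient; under [X in measurable_wrt _ X]eq_fun do rewrite -scaleN1r.
  apply: measurable_wrtZ.
  by do ?[apply: measurable_wrtD|apply: measurable_wrt_mulmx|apply: measurable_wrt_cst].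
have Z2 : sqi Z.
  rewrite /Z /explicit_gradient; under [X in sqi X]eq_fun do rewrite -scaleN1r.
  by apply: sqiZ; do ?[apply: sqiD|apply: sqi_mulmx|apply: sqi_cst].
exists Z; split; last first.
  apply: aeW => w; rewrite /Z /explicit_gradient.
  by rewrite addrAC subrr.
have iB := integrable_rand_trmx (omega2 tG) (cB L i) (cD L i) (th2 t tG).
split=> // j; split.
- exact: (L1_integrable (iB j)).
- exact: (L1_integrable (sqi_ivec Z2 j)).
move=> S FS.
have mS : measurable S := g_sigma_measurable (@mF i t) FS.
pose dv := probe i t S j.
have rd : adapted_control dv by exact: probe_adapted.
have [md d2] := rd i t tG.
have dvE (X : T -> 'cV[R]_(m i)) w : dot (X w) (dv i t w) = \1_S w * coord X j w.
  rewrite dotE (bigD1 j)//= big1 => [|k kj]; last first.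
    by rewrite /dv /probe mxE (negPf (kj : k != j :> nat)) andbF mulr0.
  by rewrite /dv /probe mxE !eqxx /= addr0 mulrC indicE.
have g0 : gradient theta v dv i t = 0.
  have := optimal_gradient sv adj rd _.
  rewrite (bigD1 (Ordinal (tG : (t < Gamma.+1)%N)))//= [X in _ + X = _]big1 ?addr0 => [|s st]; last first.
    apply: big1 => k _; apply: gradient0; apply/funext => w; apply/colP => l.
    rewrite /dv /probe !mxE (_ : (s == t :> nat) = false) ?andbF//.
    exact: negbTE st.
  rewrite (bigD1 i)//= [X in _ + X = _]big1 ?addr0 => [|k ki]; last first.
    apply: gradient0; apply/funext => w; apply/colP => l.
    by rewrite /dv /probe !mxE (negPf ki).
  apply=> k s sk; apply/funext => w; apply/colP => l; rewrite /dv /probe !mxE.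
  case: eqVneq => //= ki; case: eqVneq => //= st'.
  by exfalso; move: sk; rewrite ki st' ltnNge it.
move: g0; rewrite gradientE//; last exact: th2.
have -> : rmean (fun w => dot (explicit_gradient theta v i t w) (dv i t w)) =
   - rmean (fun w => \1_S w * coord Z j w).
  rewrite -mulN1r -rmeanZ; last first.
    have := sqi_dot Z2 d2; by under eq_fun do rewrite dvE.
  by congr rmean; apply/funext => w; rewrite dvE mulN1r -mulrN; congr (_ * _); rewrite /Z /coord [in RHS]mxE opprK.
under [X in _ + rmean X = _]eq_fun do rewrite (dvE (fun w => (B i t w)^T *m theta t w)).
move/eqP; rewrite addrC subr_eq0 => /eqP H.
have toI (f : T -> R) : (fun w => \1_S w * f w) \in L1 ->
  (\int[P]_(w in S) (f w)%:E = (rmean (fun w => \1_S w * f w))%:E)%E.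
  move=> f1; rewrite rmeanE// unlock integral_mkcond; apply: eq_integral => w _.
  by rewrite epatch_indic /= EFinM muleC.
rewrite !toI ?H//.
- rewrite (_ : (fun w => _) = fun w =>
      coord (fun w => (B i t w)^T *m theta t w) j w * coord (dv i t) j w).
    exact: (L1_rand_trmx (@mF i t) (@indep t tG i) (omega2 tG) (cB L i) (cD L i) (th2 t tG) j md d2).

  apply/funext => w; rewrite [coord (dv i t) j w]mxE !eqxx /= -indicE.
  exact: mulrC.
- by have := sqi_dot Z2 d2; under eq_fun do rewrite dvE.
Qed.

End mean_field_lq.

Theorem lemma2 (R : realType) (d : measure_display) (T : measurableType d)
    (P : probability T R) (h Gamma n : nat) (m : 'I_h.+1 -> nat)
    (L : mflq R n m) (sigma : R) (beta : T -> 'cV[R]_n)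
    (omega : nat -> {RV P >-> R}) (v0 : control T R m)
    (hGamma : (h <= Gamma)%N)
    (hweights : weights_ok L)
    (hsigma : 0 <= sigma)
    (hnoise : white_noise Gamma sigma beta omega)
    (hbeta : square_integrable P beta)
    (hv0 : initial_control P beta omega v0) :
  uniquely_solvable P Gamma (solves_problem P L Gamma beta omega v0) <->
  uniquely_solvable P Gamma (solves_equilibrium P L Gamma beta omega v0).
Proof.
have H v : solves_problem P L Gamma beta omega v0 v <->
    solves_equilibrium P L Gamma beta omega v0 v.
  split; [exact: (optimal_equilibrium hweights hnoise hbeta hv0)|
          exact: (equilibrium_optimal hweights hnoise hbeta hv0)].
by split=> -[v [/H Sv uniq]]; exists v; split => // u /H Su; exact: uniq.
Qed.
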